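(* Let $\mathbb F$ be a field and let $P(s)\in\mathbb F[s]^{m\times n}$ be a polynomial matrix with $\operatorname{rank}(P(s))=r$. Let $p_1\le\dots\le p_r$ be its invariant orders at $\infty$ and $\mathbf c=(c_1,\dots,c_{n-r})$ its column minimal indices. Let $z,x$ be integers such that $0\le x\le\min\{z,n-r\}$ and let $q_1\le\dots\le q_{r+x}$ be integers. There exists a polynomial matrix $W(s)\in\mathbb F[s]^{z\times n}$ such that $\operatorname{rank}\begin{bmatrix}P(s)\\ W(s)\end{bmatrix}=r+x$ and $\begin{bmatrix}P(s)\\ W(s)\end{bmatrix}$ has $q_1,\dots,q_{r+x}$ as invariant orders at $\infty$ if and only if $$q_i\le p_i\le q_{i+z},\quad 1\le i\le r,$$ and $$\sum_{i=1}^{r}\max\{p_i,q_{i+x-j}\}+\sum_{i=1}^{x-j}q_i-\sum_{i=1}^{r}p_i\le\sum_{i=j+1}^{x}c_i,\quad 0\le j\le x-1.$$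
   Context: $\mathbb F$ is an arbitrary field, $\mathbb F[s]$ the polynomial ring, $\mathbb F(s)$ its field of fractions, and $\mathbb F_{pr}(s)$ the ring of proper rational functions (degree of denominator at least degree of numerator). A square matrix over $\mathbb F_{pr}(s)$ is biproper if it is invertible over $\mathbb F_{pr}(s)$. Ranks are over $\mathbb F(s)$. The invariant orders at infinity of a rational (in particular polynomial) matrix $R(s)\in\mathbb F(s)^{m\times n}$ of rank $r$ are the unique integers $p_1\le\dots\le p_r$ such that $B_1(s)R(s)B_2(s)=\begin{bmatrix}\operatorname{diag}(s^{-p_1},\dots,s^{-p_r})&0\\0&0\end{bmatrix}$ for some biproper $B_1(s),B_2(s)$. A minimal basis of a subspace $\mathcal V\subseteq\mathbb F(s)^{k\times 1}$ is a basis of polynomial vectors whose sum of degrees is least among polynomial bases of $\mathcal V$; the degrees of its vectors are uniquely determined by $\mathcal V$ up to order and are the minimal indices of $\mathcal V$. The column minimal indices of $R(s)$ are the minimal indices of $\{x\in\mathbb F(s)^{n\times 1}:R(s)x=0\}$, arranged in decreasing order; there are $n-r$ of them. Convention: for an increasing sequence $b_1\le\dots\le b_k$, $b_i=-\infty$ for $i<1$ and $b_i=+\infty$ for $i>k$. Empty sums are $0$. *)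

(* Defs.v *)
From HB Require Import structures.
From mathcomp Require Import all_boot all_order all_algebra.

Set Implicit Arguments.
Unset Strict Implicit.
Unset Printing Implicit Defensive.

Import Order.TTheory GRing.Theory Num.Theory.
Local Open Scope ring_scope.

Notation ratfun F := {fraction {poly F}}.

Definition ratmx (F : fieldType) m n (A : 'M[{poly F}]_(m, n)) :
    'M[ratfun F]_(m, n) :=
  map_mx (@tofrac {poly F}) A.

(* [size] is the degree plus one, and [size 0 = 0] plays the role of degree
   minus infinity, so 0 is proper. *)
Definition proper (F : fieldType) (f : ratfun F) : Prop :=
  exists a b : {poly F},
    [/\ b != 0, (size a <= size b)%N & f = tofrac a / tofrac b].

Definition proper_mx (F : fieldType) m n (A : 'M[ratfun F]_(m, n)) : Prop :=
  forall i j, proper (A i j).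

Definition biproper (F : fieldType) n (B : 'M[ratfun F]_n) : Prop :=
  proper_mx B /\
  exists B' : 'M[ratfun F]_n,
    [/\ proper_mx B', B *m B' = 1%:M & B' *m B = 1%:M].

(* The block matrix [diag(s^-p_1, ..., s^-p_r), 0; 0, 0], where
   p = [:: p_1; ...; p_r] (so p`_i is p_(i+1)). *)
Definition smith_infty (F : fieldType) m n (p : seq int) :
    'M[ratfun F]_(m, n) :=
  \matrix_(i < m, j < n)
    if (i == j :> nat) && (i < size p)%N
    then (tofrac ('X : {poly F})) ^ (- p`_i) else 0.

Definition invariant_orders_at_infinity (F : fieldType) m n
    (R : 'M[ratfun F]_(m, n)) (p : seq int) : Prop :=
  [/\ size p = \rank R, sorted <=%O p &
      exists (B1 : 'M[ratfun F]_m) (B2 : 'M[ratfun F]_n),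
        [/\ biproper B1, biproper B2 & B1 *m R *m B2 = smith_infty F m n p]].

(* The zero vector gets degree 0, but it never belongs to a basis. *)
Definition vdeg (F : fieldType) k (v : 'cV[{poly F}]_k) : nat :=
  \max_(i < k) (size (v i ord0)).-1.

Definition polynomial_basis (F : fieldType) k (V : {vspace 'cV[ratfun F]_k})
    (X : seq 'cV[{poly F}]_k) : Prop :=
  basis_of V [seq ratmx v | v <- X].

Definition minimal_basis (F : fieldType) k (V : {vspace 'cV[ratfun F]_k})
    (X : seq 'cV[{poly F}]_k) : Prop :=
  polynomial_basis V X /\
  forall Y, polynomial_basis V Y ->
    (\sum_(v <- X) vdeg v <= \sum_(v <- Y) vdeg v)%N.

Definition minimal_indices (F : fieldType) k (V : {vspace 'cV[ratfun F]_k})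
    (c : seq nat) : Prop :=
  exists2 X, minimal_basis V X & perm_eq c [seq vdeg v | v <- X].

Definition right_kernel (F : fieldType) m n (R : 'M[ratfun F]_(m, n)) :
    {vspace 'cV[ratfun F]_n} :=
  lker (linfun (mulmx R : 'cV_n -> 'cV_m)).

Definition column_minimal_indices (F : fieldType) m n
    (R : 'M[ratfun F]_(m, n)) (c : seq nat) : Prop :=
  sorted geq c /\ minimal_indices (right_kernel R) c.

Lemma mem_right_kernel (F : fieldType) m n (R : 'M[ratfun F]_(m, n)) v :
  (v \in right_kernel R) = (R *m v == 0).
Proof. by rewrite memv_ker lfunE. Qed.

(* Main.v *)
(* The invariant orders at infinity are the Smith invariants over the valuation
   ring of proper rational functions. For necessity, choose k = x - j rows of W
   and k columns of a minimal basis N of the kernel of P, among those of index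
   at least x - k, so that the corresponding minor of W N is nonzero. Together
   with the Smith form of P this cuts out of [P; W] a square matrix with orders
   q'' such that q_i <= q''_i and p_i <= q''_(i+k), whose determinant has order
   sum p + (sum of k minimal indices) - (degree of a polynomial).

   For sufficiency, rows are added one at a time. A row matters only modulo the
   proper combinations of the rows of the current polynomial matrix M, and a
   rational combination of these rows is the sum of a polynomial and a proper
   one, so the part of the new row lying in the row space of M can be
   prescribed freely; only its order e modulo that row space is constrained.
   Put p'_i = min(p_i, q_(i+x)). First z - x rows in the row space of P change p
   into p' through interlacing sequences, then x rows lead from p' to q through
   max(q_j, p'_(j-k)), k = 0, ..., x. The gaps e_k between the sums of consecutive
   sequences are nondecreasing, their partial sums are the left-hand sides of
   the inequalities, and such e are the orders of the rows of a polynomial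
   matrix relative to minimal indices c exactly when those inequalities hold. *)
Require Import Defs.
From HB Require Import structures.
From mathcomp Require Import all_boot all_order all_algebra.
From mathcomp Require Import fingroup perm zify ring.

Set Implicit Arguments.
Unset Strict Implicit.
Unset Printing Implicit Defensive.

Import Order.TTheory GRing.Theory Num.Theory.
Local Open Scope ring_scope.

(** * Matrices over a discrete valuation ring *)

(** The value +oo of 0 has no place in [int], so the axioms speak of nonzero arguments only. *)
Record dvaluation (K : fieldType) := DValuation {
  dval :> K -> int;
  unif : K;
  dvalM : forall x y : K, x != 0 -> y != 0 -> dval (x * y) = dval x + dval y;
  dvalD : forall (t : int) (x y : K), x != 0 -> y != 0 -> x + y != 0 ->
    t <= dval x -> t <= dval y -> t <= dval (x + y);
  unif_neq0 : unif != 0;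
  dval_unif : dval unif = 1 }.

Section Valuation.
Variables (K : fieldType) (V : dvaluation K).
Local Notation pi := (unif V).

(* The valuation is at least t, with valuation +oo at 0, where V 0 is junk. *)
Definition vge (t : int) (x : K) := (x == 0) || (t <= V x).

Lemma vge0 t : vge t 0. Proof. by rewrite /vge eqxx. Qed.

Lemma vgeE t x : x != 0 -> vge t x = (t <= V x).
Proof. by rewrite /vge => x0; rewrite (negPf x0). Qed.

Lemma vgeW s t x : s <= t -> vge t x -> vge s x.
Proof. by rewrite /vge => st /orP[->//|tx]; rewrite (le_trans st tx) orbT. Qed.

Lemma vgeD t x y : vge t x -> vge t y -> vge t (x + y).
Proof.
rewrite /vge; have [->|x0] := eqVneq x 0; first by rewrite add0r.
have [->|y0] := eqVneq y 0; first by rewrite addr0 (negPf x0).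
have [//|xy0] := eqVneq (x + y) 0 => /=; exact: dvalD.
Qed.

Lemma vge_sum t (I : Type) (s : seq I) (P : pred I) (G : I -> K) :
  (forall i, P i -> vge t (G i)) -> vge t (\sum_(i <- s | P i) G i).
Proof. by move=> h; elim/big_ind: _ => //; [exact: vge0|exact: vgeD]. Qed.

Lemma vgeM s t x y : vge s x -> vge t y -> vge (s + t) (x * y).
Proof.
rewrite /vge mulf_eq0; have [//|x0] := eqVneq x 0.
have [//|y0] := eqVneq y 0 => /= sx ty.
by rewrite dvalM // lerD.
Qed.

Lemma dval1 : V 1 = 0.
Proof.
have := dvalM V (oner_neq0 K) (oner_neq0 K); rewrite mulr1 => h.
by apply: (addrI (V 1)); rewrite addr0 -h.
Qed.

Lemma dvalV x : x != 0 -> V x^-1 = - V x.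
Proof.
move=> x0; apply: (addrI (V x)).
by rewrite -dvalM ?invr_eq0 // divff // dval1 subrr.
Qed.

Lemma dvalN x : x != 0 -> V (- x) = V x.
Proof.
move=> x0; have n1 : (-1 : K) != 0 by rewrite oppr_eq0 oner_eq0.
have h : V (-1) = 0.
  have := dvalM V n1 n1; rewrite mulrNN mulr1 dval1 => /esym/eqP.
  by rewrite -mulr2n mulrn_eq0 => /eqP.
by rewrite -mulN1r dvalM // h add0r.
Qed.

Lemma vgeN t x : vge t x -> vge t (- x).
Proof.
rewrite /vge oppr_eq0; have [//|x0] := eqVneq x 0; by rewrite dvalN.
Qed.

Lemma dval_prod (I : Type) (s : seq I) (P : pred I) (G : I -> K) :
  (forall i, P i -> G i != 0) ->
  V (\prod_(i <- s | P i) G i) = \sum_(i <- s | P i) V (G i).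
Proof.
move=> h; suff [] : \prod_(i <- s | P i) G i != 0 /\
  V (\prod_(i <- s | P i) G i) = \sum_(i <- s | P i) V (G i) by [].
elim/big_rec2: _ => [|i y x Pi [x0 Ex]]; first by rewrite oner_eq0 dval1.
by rewrite mulf_neq0 ?h //  dvalM ?h // Ex.
Qed.

Lemma expu_neq0 (k : int) : pi ^ k != 0.
Proof. by rewrite expfz_neq0 ?unif_neq0. Qed.

Lemma dval_expu (k : int) : V (pi ^ k) = k.
Proof.
have h (n : nat) : V (pi ^+ n) = n.
  elim: n => [|n IH]; first by rewrite expr0 dval1.
  by rewrite exprS dvalM ?expf_neq0 ?unif_neq0 // IH dval_unif -addn1 PoszD addrC.
case: k => n; first exact: h.
by rewrite NegzE -invr_expz dvalV ?expf_neq0 ?unif_neq0 // h.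
Qed.

Lemma expuD (k l : int) : pi ^ (k + l) = pi ^ k * pi ^ l.
Proof. exact: (expfzDr _ _ (unif_neq0 V)). Qed.

Lemma vge_expu (t k : int) : t <= k -> vge t (pi ^ k).
Proof. by move=> tk; rewrite vgeE ?expu_neq0 // dval_expu. Qed.

Lemma vge1 : vge 0 1. Proof. by rewrite -(expr0z pi) vge_expu. Qed.

Lemma vge_expuM (t k : int) x : vge t (pi ^ k * x) = vge (t - k) x.
Proof.
have [->|x0] := eqVneq x 0; first by rewrite mulr0 !vge0.
rewrite !vgeE ?mulf_neq0 ?expu_neq0 // dvalM ?expu_neq0 // dval_expu; lia.
Qed.

Definition imx m n (A : 'M[K]_(m, n)) := forall i j, vge 0 (A i j).

Lemma imxM m n l (A : 'M_(m, n)) (B : 'M_(n, l)) :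
  imx A -> imx B -> imx (A *m B).
Proof.
move=> iA iB i j; rewrite mxE; apply: vge_sum => k _.
by rewrite -[0]addr0 vgeM.
Qed.

Lemma vge_mulmx t m n l (A : 'M_(m, n)) (B : 'M_(n, l)) :
  imx A -> (forall i j, vge t (B i j)) -> forall i j, vge t ((A *m B) i j).
Proof.
move=> iA iB i j; rewrite mxE; apply: vge_sum => k _.
by rewrite -[t]add0r vgeM.
Qed.

Lemma vge_mulmxr t m n l (A : 'M_(m, n)) (B : 'M_(n, l)) :
  (forall i j, vge t (A i j)) -> imx B -> forall i j, vge t ((A *m B) i j).
Proof.
move=> iA iB i j; rewrite mxE; apply: vge_sum => k _.
by rewrite -[t]addr0 vgeM.
Qed.

Lemma imxD m n (A B : 'M_(m, n)) : imx A -> imx B -> imx (A + B).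
Proof. by move=> iA iB i j; rewrite mxE vgeD. Qed.

Lemma imxN m n (A : 'M_(m, n)) : imx A -> imx (- A).
Proof. by move=> iA i j; rewrite mxE vgeN. Qed.

Lemma imx0 m n : imx (0 : 'M_(m, n)).
Proof. by move=> i j; rewrite mxE vge0. Qed.

Lemma imx1 n : imx (1%:M : 'M_n).
Proof. by move=> i j; rewrite mxE; case: eqP; rewrite ?vge1 ?vge0. Qed.

Lemma imx_row m n1 n2 (A : 'M_(m, n1)) (B : 'M_(m, n2)) :
  imx A -> imx B -> imx (row_mx A B).
Proof. by move=> iA iB i j; rewrite mxE; case: split. Qed.

Lemma imx_col m1 m2 n (A : 'M_(m1, n)) (B : 'M_(m2, n)) :
  imx A -> imx B -> imx (col_mx A B).
Proof. by move=> iA iB i j; rewrite mxE; case: split. Qed.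

Lemma imx_block m1 m2 n1 n2 (A : 'M_(m1, n1)) (B : 'M_(m1, n2))
    (C : 'M_(m2, n1)) (D : 'M_(m2, n2)) :
  imx A -> imx B -> imx C -> imx D -> imx (block_mx A B C D).
Proof. by move=> *; apply: imx_col; apply: imx_row. Qed.

Lemma imx_sub m n m' n' (f : 'I_m' -> 'I_m) (g : 'I_n' -> 'I_n) (A : 'M_(m, n)) :
  imx A -> imx (mxsub f g A).
Proof. by move=> iA i j; rewrite mxE. Qed.

Lemma imx_det n (A : 'M_n) : imx A -> vge 0 (\det A).
Proof.
move=> iA; apply: vge_sum => s _.
have h : vge 0 (\prod_i A i (s i)).
  elim/big_ind: _ => [|x y hx hy|//]; first exact: vge1.
  by rewrite -[0]addr0 vgeM.
rewrite -signr_odd; case: (odd s); rewrite ?expr1 ?expr0 ?mul1r //.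
by rewrite mulN1r vgeN.
Qed.

(** The inverse is the adjugate, which is integral, times the inverse of the determinant, which is
    integral as well. *)
Lemma imx_inv n (A : 'M_n) :
  imx A -> \det A != 0 -> V (\det A) <= 0 -> imx (invmx A).
Proof.
move=> iA dA vA; have uA : A \in unitmx by rewrite unitmxE unitfE.
rewrite /invmx uA => i j; rewrite !mxE.
have h : vge 0 (\det A)^-1 by rewrite vgeE ?invr_eq0 // dvalV // oppr_ge0.
rewrite -[0]addr0; apply: vgeM => //.
rewrite /cofactor -signr_odd; case: (odd _); rewrite ?expr1 ?expr0 ?mul1r.
  by rewrite mulN1r; apply/vgeN/imx_det => k l; rewrite !mxE.
by apply/imx_det => k l; rewrite !mxE.
Qed.

Definition iunit n (B : 'M[K]_n) :=
  imx B /\ exists B' : 'M[K]_n, [/\ imx B', B *m B' = 1%:M & B' *m B = 1%:M].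

Lemma iunit1 n : iunit (1%:M : 'M_n).
Proof. by split; [exact: imx1|exists 1%:M; split; rewrite ?mul1mx //; exact: imx1]. Qed.

Lemma iunitM n (A B : 'M_n) : iunit A -> iunit B -> iunit (A *m B).
Proof.
move=> [iA [A' [iA' AA' A'A]]] [iB [B' [iB' BB' B'B]]].
split; first exact: imxM.
exists (B' *m A'); split; first exact: imxM.
  by rewrite mulmxA -(mulmxA A) BB' mulmx1.
by rewrite mulmxA -(mulmxA B') A'A mulmx1.
Qed.

Lemma iunit_perm n (s : 'S_n) : iunit (perm_mx s).
Proof.
have h (t : 'S_n) : imx (perm_mx t).
  by move=> i j; rewrite !mxE; case: eqP; rewrite ?vge1 ?vge0.
split=> //; exists (perm_mx s^-1); split=> //.
  by rewrite -perm_mxM mulgV perm_mx1.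
by rewrite -perm_mxM mulVg perm_mx1.
Qed.

Lemma iunit_diag m n (A : 'M_m) (B : 'M_n) :
  iunit A -> iunit B -> iunit (block_mx A 0 0 B).
Proof.
move=> [iA [A' [iA' AA' A'A]]] [iB [B' [iB' BB' B'B]]].
split; first by apply: imx_block => //; exact: imx0.
exists (block_mx A' 0 0 B'); split; first by apply: imx_block => //; exact: imx0.
  by rewrite mulmx_block !mulmx0 !mul0mx !addr0 !add0r AA' BB' -scalar_mx_block.
by rewrite mulmx_block !mulmx0 !mul0mx !addr0 !add0r A'A B'B -scalar_mx_block.
Qed.

Lemma iunit_lower m n (C : 'M_(n, m)) :
  imx C -> iunit (block_mx 1%:M 0 C 1%:M).
Proof.
move=> iC; split; first by apply: imx_block => //; try exact: imx1; exact: imx0.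
exists (block_mx 1%:M 0 (- C) 1%:M); split.
- by apply: imx_block; try exact: imx1; try exact: imx0; exact: imxN.
- by rewrite mulmx_block !mulmx0 !mul0mx !mulmx1 !mul1mx !addr0 !add0r subrr -scalar_mx_block.
- by rewrite mulmx_block !mulmx0 !mul0mx !mulmx1 !mul1mx !addr0 !add0r addNr -scalar_mx_block.
Qed.

Lemma iunit_upper m n (C : 'M_(m, n)) :
  imx C -> iunit (block_mx 1%:M C 0 1%:M).
Proof.
move=> iC; split; first by apply: imx_block => //; try exact: imx1; exact: imx0.
exists (block_mx 1%:M (- C) 0 1%:M); split.
- by apply: imx_block; try exact: imx1; try exact: imx0; exact: imxN.
- by rewrite mulmx_block !mulmx0 !mul0mx !mulmx1 !mul1mx !addr0 !add0r addNr -scalar_mx_block.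
- by rewrite mulmx_block !mulmx0 !mul0mx !mulmx1 !mul1mx !addr0 !add0r subrr -scalar_mx_block.
Qed.

Lemma row_min n (u : 'rV[K]_n) : u != 0 ->
  exists2 j, u ord0 j != 0 & forall i, vge (V (u ord0 j)) (u ord0 i).
Proof.
case/rV0Pn=> j0 nz0.
case: (Order.TotalTheory.arg_minP (fun j => V (u ord0 j))
  (P := fun j => u ord0 j != 0) nz0) => j nz h.
exists j => // i; rewrite /vge; case: eqVneq => //= ui; exact: h.
Qed.

End Valuation.

(** * Smith form over a valuation ring *)

Section Smith.
Variables (K : fieldType) (V : dvaluation K).
Local Notation pi := (unif V).
Local Notation vge := (vge V).
Local Notation imx := (imx V).
Local Notation iunit := (iunit V).

Definition nondec (r : nat) (p : nat -> int) :=
  forall i j, (i <= j)%N -> (j < r)%N -> p i <= p j.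

Definition smith m n (r : nat) (p : nat -> int) : 'M[K]_(m, n) :=
  \matrix_(i < m, j < n)
    if (i == j :> nat) && (i < r)%N then pi ^ p i else 0.

Definition dg r (p : nat -> int) : 'M[K]_r := smith r r r p.

Lemma smithS m n r p :
  smith m.+1 n.+1 r.+1 p =
    block_mx (pi ^ p 0%N)%:M 0 0 (smith m n r (fun i => p i.+1))
      :> 'M_(1 + m, 1 + n).
Proof.
apply/matrixP => i j; rewrite !mxE.
case: splitP => i' ei; rewrite !mxE; case: splitP => j' ej; rewrite !mxE ei ej.
- by rewrite !ord1 eqxx mulr1n.
- by rewrite ord1 addnC addn1.
- by rewrite ord1 addnC addn1.
- by rewrite !add1n eqSS ltnS.
Qed.

(** Elimination with an entry of least valuation as pivot: it divides all other entries, so its row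
    and column are cleared by integral operations. *)
Lemma smith_exists m n (M : 'M[K]_(m, n)) :
  exists r p (B1 : 'M_m) (B2 : 'M_n),
    [/\ (r <= m)%N, (r <= n)%N, nondec r p, iunit B1 /\ iunit B2
      & B1 *m M *m B2 = smith m n r p].
Proof.
have triv m' n' (M' : 'M[K]_(m', n')) : M' = 0 -> exists r p (B1 : 'M_m') (B2 : 'M_n'),
    [/\ (r <= m')%N, (r <= n')%N, nondec r p, iunit B1 /\ iunit B2
      & B1 *m M' *m B2 = smith m' n' r p].
  move=> ->; exists 0%N, (fun=> 0), 1%:M, 1%:M; split=> //.
    by split; exact: iunit1.
  by rewrite mulmx0 mul0mx; apply/matrixP=> i j; rewrite !mxE andbF.
elim: m n M => [|m IH] [|n] M.
- by apply: triv; apply/matrixP => -[].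
- by apply: triv; apply/matrixP => -[].
- by apply: triv; apply/matrixP => ? -[].
have [->|nzM] := eqVneq M 0; first exact: triv.
have [[i0 j0] /= nz0 min0] : exists2 ij : 'I_m.+1 * 'I_n.+1, M ij.1 ij.2 != 0 &
    forall i j, vge (V (M ij.1 ij.2)) (M i j).
  have [i1 [j1 nz1]] := matrix0Pn _ nzM.
  case: (Order.TotalTheory.arg_minP (fun ij : 'I_m.+1 * 'I_n.+1 => V (M ij.1 ij.2))
    (P := fun ij => M ij.1 ij.2 != 0) (i0 := (i1, j1)) nz1) => ij nz h.
  exists ij => // i j; rewrite /vge; case: eqVneq => //= ui; exact: (h (i, j)).
set k := V (M i0 j0) in min0.
have [M1 defM1] : exists M1 : 'M_(1 + m, 1 + n),
  M1 = tperm_mx ord0 i0 *m M *m tperm_mx ord0 j0 by eexists.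
have EM1 : M1 = xcol ord0 j0 (xrow ord0 i0 M) by rewrite defM1 -xrowE -xcolE.
have a0 : M1 ord0 ord0 = M i0 j0 by rewrite EM1 !mxE !tpermL.
have M1k i j : vge k (M1 i j) by rewrite EM1 !mxE.
set a := M i0 j0 in nz0 a0 k min0 M1k.
have EM : M1 = block_mx a%:M (ursubmx M1) (dlsubmx M1) (drsubmx M1).
  rewrite -[LHS]submxK; congr block_mx.
  apply/matrixP => i j; rewrite !ord1 !mxE eqxx mulr1n -a0.
  by congr (M1 _ _); apply: val_inj.
set u := ursubmx M1 in EM; set w := dlsubmx M1 in EM; set R := drsubmx M1 in EM.
have va x : vge k x -> vge 0 (a^-1 * x).
  move=> hx; have -> : 0 = - k + k by rewrite addNr.
  by apply: vgeM => //; rewrite vgeE ?invr_eq0 // dvalV.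
have iu : imx (- (a^-1 *: u)) by apply: imxN => i j; rewrite !mxE; apply: va.
have iw : imx (- (a^-1 *: w)) by apply: imxN => i j; rewrite !mxE; apply: va.
have [r [p [B1 [B2 [rm rn ndp [uB1 uB2] EB]]]]] := IH _ (R - a^-1 *: (w *m u)).
(* The Schur complement keeps entries of valuation at least [k], so its orders are at least [k] and
   the pivot may come first. *)
have R2k i j : vge k ((R - a^-1 *: (w *m u)) i j).
  rewrite mxE; apply: vgeD; first by rewrite !mxE; exact: M1k.
  rewrite mxE; apply: vgeN; rewrite scalemxAl.
  apply: vge_mulmx => i1 j1; first by rewrite !mxE; apply: va; exact: M1k.
  by rewrite !mxE; exact: M1k.
have hp i : (i < r)%N -> k <= p i.
  move=> ir; have im := leq_trans ir rm; have jn := leq_trans ir rn.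
  have : vge k (smith m n r p (Ordinal im) (Ordinal jn)).
    rewrite -EB; apply: vge_mulmxr; last by case: uB2.
    by apply: vge_mulmx => //; case: uB1.
  by rewrite mxE /= eqxx ir vgeE ?expu_neq0 // dval_expu.
exists r.+1, (fun i => if i is i'.+1 then p i' else k).
(* The factor [pi ^ k * a^-1] is a unit that turns the pivot [a] into [pi ^ k]. *)
exists (block_mx ((pi ^ k * a^-1)%:M) 0 0 B1 *m block_mx 1%:M 0 (- (a^-1 *: w)) 1%:M
        *m tperm_mx ord0 i0).
exists (tperm_mx ord0 j0 *m block_mx 1%:M (- (a^-1 *: u)) 0 1%:M
        *m block_mx 1%:M 0 0 B2).
split=> //.
- by case=> [|i] [|j] //= ij; [exact: hp|exact: ndp].
- split.
    apply: iunitM; last exact: iunit_perm.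
    apply: iunitM; last exact: (iunit_lower iw).
    apply: (@iunit_diag _ V 1 m) => //.
    have us x : x != 0 -> V x = 0 -> imx (x%:M : 'M_1).
      move=> x0 vx i j; rewrite !ord1 mxE eqxx vgeE //; by rewrite mulr1n vx.
    split.
      apply: us; first by rewrite mulf_neq0 ?expu_neq0 ?invr_eq0.
      by rewrite dvalM ?expu_neq0 ?invr_eq0 // dval_expu dvalV // subrr.
    have e : pi ^ k * a^-1 * (pi ^ (- k) * a) = 1.
      rewrite mulrACA -expuD subrr expr0z mul1r mulVf //.
    exists (pi ^ (- k) * a)%:M; split.
    + apply: us; first by rewrite mulf_neq0 ?expu_neq0.
      by rewrite dvalM ?expu_neq0 // dval_expu addNr.
    + by rewrite -scalar_mxM e.
    + by rewrite -scalar_mxM mulrC e.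
  apply: iunitM; last by apply: (@iunit_diag _ V 1 n) => //; exact: iunit1.
  apply: iunitM; first exact: iunit_perm.
  exact: (iunit_upper iu).
have E1 : block_mx 1%:M 0 (- (a^-1 *: w)) 1%:M *m M1 *m
    block_mx 1%:M (- (a^-1 *: u)) 0 1%:M
    = block_mx a%:M 0 0 (R - a^-1 *: (w *m u)).
  rewrite EM !mulmx_block !mulmx1 !mulmx0 !mul0mx !mul1mx !addr0.
  rewrite mulNmx -scalemxAl mul_mx_scalar scalerA mulVf // scale1r addNr.
  rewrite mul0mx add0r mulmxN mul_scalar_mx scalerA divff // scale1r addNr.
  by rewrite mulNmx -scalemxAl addrC.
transitivity (block_mx (pi ^ k * a^-1)%:M 0 0 B1 *m
   (block_mx 1%:M 0 (- (a^-1 *: w)) 1%:M *m M1 *m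
    block_mx 1%:M (- (a^-1 *: u)) 0 1%:M) *m block_mx 1%:M 0 0 B2).
  by rewrite defM1 !mulmxA.
rewrite E1 !mulmx_block !(mulmx1, mulmx0, mul0mx, addr0, add0r) EB.
by rewrite smithS -scalar_mxM -mulrA mulVf // mulr1.
Qed.

End Smith.

(** * Invariant orders of a matrix *)

Section Orders.
Variables (K : fieldType) (V : dvaluation K).
Local Notation pi := (unif V).
Local Notation vge := (vge V).
Local Notation imx := (imx V).
Local Notation iunit := (iunit V).
Local Notation smith := (smith V).
Local Notation dg := (dg V).

(* M is diag(pi^p_0, ..., pi^p_(r-1)) up to integral injections and
   projections; unlike the Smith form this does not refer to the size of M. *)
Definition has_orders m n (M : 'M[K]_(m, n)) r p :=
  nondec r p /\
  exists (S : 'M_(m, r)) (S' : 'M_(r, m)) (T : 'M_(r, n)) (T' : 'M_(n, r)),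
    [/\ imx S /\ imx S', imx T /\ imx T', S' *m S = 1%:M, T *m T' = 1%:M
      & M = S *m dg r p *m T].

Lemma dgE r p : dg r p = diag_mx (\row_j pi ^ p j).
Proof.
apply/matrixP => i j; rewrite !mxE ltn_ord andbT.
by rewrite -val_eqE /=; case: eqP => // /val_inj ->.
Qed.

Lemma det_dg r p : \det (dg r p) = \prod_(i < r) pi ^ p i.
Proof. by rewrite dgE det_diag; apply: eq_bigr => i _; rewrite mxE. Qed.

Lemma det_dg_neq0 r p : \det (dg r p) != 0.
Proof. by rewrite det_dg; apply/prodf_neq0 => i _; apply: expu_neq0. Qed.

Lemma dg_unit r p : dg r p \in unitmx.
Proof. by rewrite unitmxE unitfE det_dg_neq0. Qed.

Lemma mul_dg m r p (A : 'M_(m, r)) i j : (A *m dg r p) i j = A i j * pi ^ p j.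
Proof. by rewrite dgE mul_mx_diag !mxE. Qed.

Lemma dg_mul m r p (A : 'M_(r, m)) i j : (dg r p *m A) i j = pi ^ p i * A i j.
Proof. by rewrite dgE mul_diag_mx !mxE. Qed.

Lemma imx_pid m n r : imx (pid_mx r : 'M_(m, n)).
Proof. by move=> i j; rewrite !mxE; case: andP; rewrite ?vge1 ?vge0. Qed.

Lemma pid_pid r m : (r <= m)%N ->
  (pid_mx r : 'M[K]_(r, m)) *m (pid_mx r : 'M_(m, r)) = 1%:M.
Proof. by move=> rm; rewrite mul_pid_mx minnn (minn_idPr rm) pid_mx_1. Qed.

Lemma smith_dg m n r p : (r <= m)%N -> (r <= n)%N ->
  smith m n r p = (pid_mx r : 'M_(m, r)) *m dg r p *m (pid_mx r : 'M_(r, n)).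
Proof.
move=> rm rn; apply/matrixP => i j; rewrite [LHS]mxE [RHS]mxE.
have [ir|ir] := ltnP i r; last first.
  rewrite andbF big1 // => k _; rewrite mul_dg !mxE.
  by rewrite ltnNge ir andbF !mul0r.
rewrite (bigD1 (Ordinal ir)) //= mul_dg !mxE /= eqxx ir mul1r andbT.
rewrite big1 ?addr0 => [|k]; last first.
  by rewrite -val_eqE eq_sym mul_dg mxE /= => /negPf ->; rewrite !mul0r.
by case: eqP; rewrite ?mulr1 ?mulr0.
Qed.

Lemma smith_orders m n (M : 'M_(m, n)) r p (B1 : 'M_m) (B2 : 'M_n) :
    (r <= m)%N -> (r <= n)%N -> nondec r p -> iunit B1 -> iunit B2 ->
  B1 *m M *m B2 = smith m n r p -> has_orders M r p.
Proof.
move=> rm rn ndp [i1 [C1 [j1 e1 e1']]] [i2 [C2 [j2 e2 e2']]] E; split=> //.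
exists (C1 *m pid_mx r), (pid_mx r *m B1), (pid_mx r *m C2), (B2 *m pid_mx r).
split.
- by split; apply: imxM => //; exact: imx_pid.
- by split; apply: imxM => //; exact: imx_pid.
- by rewrite mulmxA -(mulmxA _ B1) e1 mulmx1 pid_pid.
- by rewrite mulmxA -(mulmxA _ C2) e2' mulmx1 pid_pid.
- rewrite -!mulmxA (mulmxA (pid_mx r)) (mulmxA (pid_mx r *m _)) -smith_dg // -E.
  by rewrite -!mulmxA e2 mulmx1 mulmxA e1' mul1mx.
Qed.

Lemma has_orders_exists m n (M : 'M[K]_(m, n)) : exists r p, has_orders M r p.
Proof.
have [r [p [B1 [B2 [rm rn ndp [u1 u2] E]]]]] := smith_exists V M.
by exists r, p; apply: smith_orders E.
Qed.

Lemma has_orders_rank m n (M : 'M[K]_(m, n)) r p : has_orders M r p -> \rank M = r.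
Proof.
case=> _ [S [S' [T [T' [_ _ eS eT ->]]]]]; apply/eqP; rewrite eqn_leq.
apply/andP; split; first by rewrite -mulmxA (leq_trans (mxrankM_maxl _ _)) // rank_leq_col.
have E : S' *m (S *m dg r p *m T) *m T' = dg r p.
  by rewrite !mulmxA eS mul1mx -mulmxA eT mulmx1.
rewrite -{1}(mxrank_unit (dg_unit r p)) -{1}E.
by rewrite (leq_trans (mxrankM_maxl _ _)) // mxrankM_maxr.
Qed.

Lemma wide_ker k l (H : 'M[K]_(k, l)) : (l < k)%N ->
  exists2 u : 'rV_k, u != 0 & u *m H = 0.
Proof.
move=> lk; have nz : kermx H != 0.
  rewrite -mxrank_eq0 mxrank_ker subn_eq0 -ltnNge.
  exact: leq_ltn_trans (rank_leq_col H) lk.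
exists (nz_row (kermx H)); first by rewrite nz_row_eq0.
by apply/eqP; rewrite -sub_kermx nz_row_sub.
Qed.

(** Dividing a kernel vector by [pi] to its least valuation makes one entry a unit. *)
Lemma primitive_ker k l (H : 'M[K]_(k, l)) : (l < k)%N ->
  exists u : 'rV_k, [/\ imx u, u *m H = 0 & exists2 j, u ord0 j != 0 & V (u ord0 j) = 0].
Proof.
move=> lk; have [u u0 uH] := wide_ker H lk; have [j uj hu] := row_min V u0.
exists (pi ^ (- V (u ord0 j)) *: u); split; last 1 first.
- exists j; rewrite mxE; first by rewrite mulf_neq0 ?expu_neq0.
  by rewrite dvalM ?expu_neq0 // dval_expu addNr.
- by move=> a b; rewrite (ord1 a) mxE vge_expuM sub0r opprK; exact: hu.
- by rewrite -scalemxAl uH scaler0.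
Qed.

(* A non-archimedean Courant-Fischer argument: on a space of dimension i+t+1
   the matrix M has orders at most q_(i+t), and t+i linear conditions bring M
   into the image of R and kill the first i invariant orders of R. *)
Lemma interlace mM nM mR nR t (M : 'M_(mM, nM)) (R : 'M_(mR, nR))
    (L : 'M_(mM, t)) (A : 'M_(mM, mR)) (B : 'M_(nR, nM)) k q r p i :
  has_orders M k q -> has_orders R r p -> imx A -> imx B ->
  (forall u : 'rV_mM, u *m L = 0 -> u *m M = u *m A *m R *m B) ->
  (i + t < k)%N -> (i < r)%N /\ p i <= q (i + t)%N.
Proof.
move=> [ndq [S [S' [T [T' [[iS iS'] [iT iT'] eS eT eM]]]]]].
move=> [ndp [X [X' [Y [Y' [[iX iX'] [iY iY'] eX eY eR]]]]]] iA iB hL itk.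
pose E : 'M[K]_((i + t).+1, k) := pid_mx (i + t).+1.
have iE : imx E by exact: imx_pid.
(* There are [i + t + 1] unknowns: [t] equations impose the condition on [L], and [i] more kill the
   first [i] coordinates of [a] below. *)
have [|u [iu uH [j uj vj]]] := @primitive_ker (i + t).+1 (t + i)
   (row_mx (E *m S' *m L) (E *m S' *m A *m X *m pid_mx i)).
  by rewrite addnC ltnSn.
move: uH; rewrite mul_mx_row -row_mx0 => /eq_row_mx [uL uP].
have jk : (j < k)%N by apply: leq_trans itk; apply: ltn_ord.
have uEj : (u *m E) ord0 (Ordinal jk) = u ord0 j.
  rewrite mxE (bigD1 j) //= big1 ?addr0; last first.
    move=> l lj; rewrite mxE /= [l == j :> nat]eqn_leq -eqn_leq.
    by rewrite val_eqE (negPf lj) mulr0.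
  by rewrite mxE /= eqxx ltn_ord mulr1.
set a := u *m E *m S' *m A *m X.
have ia : imx a by do ![apply: imxM => //].
have a0 (l : 'I_r) : (l < i)%N -> a ord0 l = 0.
  move=> li; have /matrixP/(_ ord0 (Ordinal li)) := uP.
  rewrite !mulmxA -/a mxE (bigD1 l) //= big1 ?addr0.
    by rewrite [pid_mx _ _ _]mxE /= eqxx li mulr1 => ->; rewrite mxE.
  by move=> l'; rewrite -val_eqE [pid_mx _ _ _]mxE /= => /negPf ->; rewrite mulr0.
have key : u *m E *m dg k q = a *m dg r p *m (Y *m B *m T').
  have uL' : u *m E *m S' *m L = 0 by rewrite -uL !mulmxA.
  move: (hL _ uL').
  rewrite eM eR => /(congr1 (mulmx^~ T')); rewrite !mulmxA.
  rewrite -(mulmxA _ S') eS mulmx1 -(mulmxA _ T) eT mulmx1 => ->.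
  by [].
have nz : (u *m E *m dg k q) ord0 (Ordinal jk) != 0.
  by rewrite mul_dg uEj mulf_neq0 ?expu_neq0.
(* For [i >= r] every coordinate of [a] would be killed, against [nz]. *)
have [ir|ri] := ltnP i r; last first.
  suff a00 : a = 0 by move: nz; rewrite key a00 !mul0mx mxE eqxx.
  by apply/rowP => l; rewrite a0 ?mxE // (leq_trans (ltn_ord l)).
(* Coordinate [j] has valuation exactly [q j], since [u] has a unit there, and [j <= i + t]. The
   other side only involves orders at least [p i]. *)
split=> //; have : vge (p i) ((u *m E *m dg k q) ord0 (Ordinal jk)).
  rewrite key; apply: vge_mulmxr; last by do ![apply: imxM => //].
  move=> b l; rewrite mul_dg ord1; have [li|il] := ltnP l i.
    by rewrite a0 // mul0r vge0.
  by rewrite mulrC vge_expuM; apply: vgeW (ia _ _); rewrite subr_le0 ndp.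
rewrite vgeE // mul_dg uEj dvalM ?expu_neq0 // dval_expu vj add0r => h.
by apply: le_trans h _; apply: ndq; rewrite //= -ltnS ltn_ord.
Qed.

(** The case [t = 0] of [interlace], with no linear condition. *)
Lemma has_orders_le mM nM mR nR (M : 'M_(mM, nM)) (R : 'M_(mR, nR))
    (A : 'M_(mM, mR)) (B : 'M_(nR, nM)) k q r p :
  has_orders M k q -> has_orders R r p -> imx A -> imx B ->
  M = A *m R *m B -> (k <= r)%N /\ forall i, (i < k)%N -> p i <= q i.
Proof.
move=> hM hR iA iB E.
have h i : (i < k)%N -> (i < r)%N /\ p i <= q i.
  have := @interlace _ _ _ _ 0 M R 0 A B k q r p i hM hR iA iB.
  rewrite addn0; apply=> u _; by rewrite E !mulmxA.
split=> [|i ik]; last by case: (h i ik).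
by case: k hM h => // k _ /(_ k (ltnSn k)) [].
Qed.

Lemma eq_has_orders m n (M : 'M_(m, n)) r p q :
  (forall i, (i < r)%N -> p i = q i) -> has_orders M r p -> has_orders M r q.
Proof.
move=> e [ndp h]; split=> [i j ij jr|]; first by rewrite -!e ?ndp ?(leq_ltn_trans ij).
suff <- : dg r p = dg r q by [].
by rewrite !dgE; congr diag_mx; apply/rowP => j; rewrite !mxE e.
Qed.

(* The two factorizations put no size constraint on M and R, so this covers
   dropping zero rows and permuting or duplicating rows. *)
Lemma has_orders_equiv mM nM mR nR (M : 'M_(mM, nM)) (R : 'M_(mR, nR))
    (A : 'M_(mM, mR)) (B : 'M_(nR, nM)) (A' : 'M_(mR, mM)) (B' : 'M_(nM, nR)) r p :
  imx A -> imx B -> imx A' -> imx B' -> M = A *m R *m B -> R = A' *m M *m B' ->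
  has_orders R r p -> has_orders M r p.
Proof.
move=> iA iB iA' iB' EM ER hR; have [k [q hM]] := has_orders_exists M.
have [kr h1] := has_orders_le hM hR iA iB EM.
have [rk h2] := has_orders_le hR hM iA' iB' ER.
have e : r = k by apply/eqP; rewrite eqn_leq rk.
subst k; apply: eq_has_orders hM => i ir.
by apply/eqP; rewrite eq_le h1 // h2.
Qed.

Lemma has_orders_uniq m n (M : 'M_(m, n)) r p r' p' :
  has_orders M r p -> has_orders M r' p' ->
  r = r' /\ forall i, (i < r)%N -> p i = p' i.
Proof.
move=> h h'; have E : M = 1%:M *m M *m 1%:M by rewrite mul1mx mulmx1.
have [a b] := has_orders_le h h' (@imx1 _ V _) (@imx1 _ V _) E.
have [a' b'] := has_orders_le h' h (@imx1 _ V _) (@imx1 _ V _) E.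
split=> [|i ir]; first by apply/eqP; rewrite eqn_leq a.
by apply/eqP; rewrite eq_le b // b' // (leq_trans ir).
Qed.

Lemma has_orders_dg r p : nondec r p -> has_orders (dg r p) r p.
Proof.
move=> ndp; split=> //; exists 1%:M, 1%:M, 1%:M, 1%:M.
by split; rewrite ?mulmx1 ?mul1mx //; split; exact: imx1.
Qed.

(** Here [S] and [T] are square with integral inverses, so their determinants have valuation 0. *)
Lemma has_orders_det r p (M : 'M_r) : has_orders M r p ->
  \det M != 0 /\ V (\det M) = \sum_(i < r) p i.
Proof.
case=> _ [S [S' [T [T' [[iS iS'] [iT iT'] eS eT ->]]]]].
have h (A B : 'M_r) : imx A -> imx B -> A *m B = 1%:M -> \det A != 0 /\ V (\det A) = 0.
  move=> iA iB /(congr1 determinant); rewrite det_mulmx det1 => e.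
  have : \det A * \det B != 0 by rewrite e oner_neq0.
  rewrite mulf_eq0 negb_or => /andP[a0 b0]; split=> //.
  have := imx_det iA; rewrite vgeE // => va.
  have := imx_det iB; rewrite vgeE // => vb.
  have := congr1 V e; rewrite dvalM // dval1; move: va vb; clear.
  by move: (V (\det A)) (V (\det B)) => a b; lia.
have [S0 vS] := h _ _ iS iS' (mulmx1C eS); have [T0 vT] := h _ _ iT iT' eT.
rewrite !det_mulmx !mulf_neq0 ?det_dg_neq0 //; split=> //.
rewrite !dvalM ?mulf_neq0 ?det_dg_neq0 // vS vT addr0 add0r det_dg dval_prod.
  by apply: eq_bigr => i _; rewrite dval_expu.
by move=> i _; apply: expu_neq0.
Qed.

End Orders.

(** * Adding one row *)

Section Step.
Variables (K : fieldType) (V : dvaluation K).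
Local Notation pi := (unif V).
Local Notation vge := (vge V).
Local Notation imx := (imx V).
Local Notation smith := (smith V).
Local Notation dg := (dg V).
Local Notation has_orders := (has_orders V).

(** The lattice generated by the rows of [C] over the valuation ring. *)
Definition inlat m n (y : 'rV[K]_n) (C : 'M_(m, n)) :=
  exists2 u : 'rV_m, imx u & y = u *m C.

Lemma inlat_row m n i (C : 'M[K]_(m, n)) : inlat (row i C) C.
Proof.
exists (delta_mx 0 i); last by rewrite -rowE.
by move=> a b; rewrite mxE; case: andP; rewrite ?vge1 ?vge0.
Qed.

Lemma inlat0 m n (C : 'M[K]_(m, n)) : inlat 0 C.
Proof. by exists 0; [exact: imx0|rewrite mul0mx]. Qed.

Lemma inlatB m n y z (C : 'M[K]_(m, n)) : inlat y C -> inlat z C -> inlat (y - z) C.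
Proof.
move=> [u iu ->] [v iv ->]; exists (u - v); last by rewrite mulmxBl.
by apply: imxD => //; exact: imxN.
Qed.

Lemma inlatZ m n x y (C : 'M[K]_(m, n)) : vge 0 x -> inlat y C -> inlat (x *: y) C.
Proof.
move=> vx [u iu ->]; exists (x *: u); last by rewrite scalemxAl.
by move=> a b; rewrite mxE -[0]addr0 vgeM.
Qed.

Lemma inlat_mx l m n (N : 'M[K]_(l, n)) (C : 'M[K]_(m, n)) :
  (forall i, inlat (row i N) C) -> exists2 A, imx A & N = A *m C.
Proof.
move=> h; have h' i : exists u : 'rV_m, imx u /\ row i N = u *m C.
  by have [u] := h i; exists u.
have [g hg] := fin_all_exists h'.
exists (\matrix_i g i) => [i j|]; first by rewrite mxE; case: (hg i).
by apply/row_matrixP => i; rewrite row_mul rowK; case: (hg i).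
Qed.

Section StepMatrix.
Variables (rho k : nat) (p q : nat -> int).
Hypotheses (kr : (k <= rho.+1)%N) (ndq : nondec k q).
Hypotheses (qp : forall i, (i < rho)%N -> q i <= p i).
Hypotheses (pq : forall i, (i.+1 < k)%N -> p i <= q i.+1).

(* Below the row (pi^step_exp_j)_j, the rows pi^p_i eps_i recover one by one
   the rows of diag(pi^q) times a unitriangular matrix. *)
Definition step_exp j := \sum_(i < j.+1) q i - \sum_(i < j) p i.

Definition step_mx : 'M[K]_(1 + rho, k) :=
  col_mx (\row_j pi ^ step_exp j) (smith rho k rho p).

Let C l : 'rV[K]_k := \row_j if (l <= j)%N then pi ^ (q l + step_exp j - step_exp l) else 0.

Let step_exp0 : step_exp 0 = q 0%N.
Proof. by rewrite /step_exp big_ord_recl !big_ord0 addr0 subr0. Qed.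

Let step_expS j : step_exp j.+1 = step_exp j + q j.+1 - p j.
Proof. by rewrite /step_exp big_ord_recr /= [\sum_(i < j.+1) p i]big_ord_recr /=; ring. Qed.

Let step_exp_homo i j : (i <= j)%N -> (j < k)%N -> step_exp i <= step_exp j.
Proof.
elim: j => [|j IH]; first by rewrite leqn0 => /eqP->.
rewrite leq_eqVlt => /orP[/eqP-> //|ij jk].
apply: le_trans (IH ij (ltnW jk)) _; rewrite step_expS -addrA lerDl subr_ge0.
exact: pq.
Qed.

Let row_top : \row_j pi ^ step_exp j = C 0%N.
Proof. by apply/rowP => j; rewrite !mxE step_exp0 addrAC subrr add0r. Qed.

(** The exponents [step_exp] are such that the two rows on the right agree in all columns beyond
    [i], leaving only the diagonal entry. *)
Let row_low (i : 'I_rho) :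
  row i (smith rho k rho p) = pi ^ (p i - q i) *: C i - C i.+1.
Proof.
apply/rowP => j; rewrite !mxE ltn_ord andbT.
case: (ltngtP i j) => [ij|ji|<-].
- rewrite -expuD step_expS; apply/eqP; rewrite eq_sym subr_eq0; apply/eqP.
  by congr (pi ^ _); ring.
- by rewrite mulr0 subr0.
- by rewrite -expuD subr0; congr (pi ^ _); ring.
Qed.

Let C0 l : (k <= l)%N -> C l = 0.
Proof.
move=> kl; apply/rowP => j; rewrite !mxE leqNgt.
by rewrite (leq_trans (ltn_ord j) kl).
Qed.

Let C_step l : inlat (C l) step_mx.
Proof.
elim: l => [|l IH].
  have := inlat_row (lshift rho 0) step_mx.
  by rewrite rowKu -row_top; congr inlat; apply/rowP => j; rewrite !mxE.
(* For [l >= rho] the row [C l.+1] vanishes because [k <= rho.+1]; otherwise [row_low] is solved for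
   it. *)
have [lr|rl] := ltnP l rho; last by rewrite C0 ?(leq_trans kr) //; exact: inlat0.
have -> : C l.+1 = pi ^ (p l - q l) *: C l - row (rshift 1 (Ordinal lr)) step_mx.
  by rewrite rowKd row_low opprB addrC subrK.
apply: inlatB; last exact: inlat_row.
by apply: inlatZ => //; apply: vge_expu; rewrite subr_ge0 qp.
Qed.

Let B : 'M[K]_k := \matrix_(i, j) if (i <= j)%N then pi ^ (step_exp j - step_exp i) else 0.

Let CB : dg k q *m B = \matrix_l C l.
Proof.
apply/matrixP => i j; rewrite dg_mul !mxE; case: ifP => // _; last by rewrite mulr0.
by rewrite -expuD addrA.
Qed.

Let B_int : imx B.
Proof.
move=> i j; rewrite mxE; case: ifP => ij; last exact: vge0.
by apply: vge_expu; rewrite subr_ge0 step_exp_homo.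
Qed.

Let B_det : \det B = 1.
Proof.
rewrite -det_tr det_trig; last first.
  apply/is_trig_mxP => i j ij; by rewrite !mxE leqNgt ij.
by apply: big1 => i _; rewrite !mxE leqnn subrr expr0z.
Qed.

(** The rows of [step_mx] and those of [dg k q *m B] generate the same lattice, and [B] is integral
    of determinant 1. *)
Lemma step_mx_orders : has_orders step_mx k q.
Proof.
have [A iA EA] : exists2 A, imx A & step_mx = A *m \matrix_(l < k) C l.
  have inC l : inlat (C l) (\matrix_(l < k) C l).
    have [lk|kl] := ltnP l k; last by rewrite C0 //; exact: inlat0.
    by have := inlat_row (Ordinal lk) (\matrix_(l < k) C l); rewrite rowK.
  apply: inlat_mx => i; rewrite -[i]splitK; case: (split i) => i' /=.
    by rewrite rowKu; have -> : row i' (\row_j pi ^ step_exp j) = C 0%N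
      by rewrite -row_top; apply/rowP => j; rewrite !mxE.
  rewrite rowKd row_low; apply: inlatB => //.
  by apply: inlatZ => //; apply: vge_expu; rewrite subr_ge0 qp.
have [A' iA' EA'] : exists2 A', imx A' & \matrix_(l < k) C l = A' *m step_mx.
  by apply: inlat_mx => i; rewrite rowK.
have uB : B \in unitmx by rewrite unitmxE B_det unitr1.
apply: (has_orders_equiv (A := A) (B := B) (A' := A') (B' := invmx B) (R := dg k q)) => //.
- by apply: imx_inv; rewrite ?B_det ?oner_eq0 ?dval1.
- by rewrite EA -CB mulmxA.
- by rewrite -EA' -CB mulmxK.
- exact: has_orders_dg.
Qed.

End StepMatrix.
Lemma mul_diag_col m r n (S : 'M[K]_(m, r)) (x : 'rV_n) (D : 'M_(r, n)) :
  (block_mx 1%:M 0 0 S : 'M_(1 + m, 1 + r)) *m col_mx x D = col_mx x (S *m D).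
Proof. by rewrite mul_block_col mul1mx !mul0mx addr0 add0r. Qed.

(** In the coordinates given by [S] and [T] the matrix is [dg rho p], and [step_mx] with [k = rho]
    supplies the extra row. *)
Lemma add_row_same m n (M : 'M[K]_(m, n)) rho p q :
    has_orders M rho p -> nondec rho q ->
    (forall i, (i < rho)%N -> q i <= p i) ->
    (forall i, (i.+1 < rho)%N -> p i <= q i.+1) ->
  exists u : 'rV_m, has_orders (col_mx (u *m M) M) rho q.
Proof.
move=> [ndp [S [S' [T [T' [[iS iS'] [iT iT'] eS eT eM]]]]]] ndq qp pq.
have hN := step_mx_orders (leqnSn rho) ndq qp pq.
pose x : 'rV[K]_rho := \row_j pi ^ step_exp p q j.
exists (x *m invmx (dg rho p) *m S').
have -> : x *m invmx (dg rho p) *m S' *m M = x *m T.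
  by rewrite eM -!mulmxA (mulmxA S') eS mul1mx mulKmx // dg_unit.
have iD r r' (X : 'M_(r, r')) : imx X -> imx (block_mx 1%:M 0 0 X : 'M_(1 + _, 1 + _)).
  by move=> iX; apply: imx_block => //; [exact: imx1|exact: imx0|exact: imx0].
apply: (has_orders_equiv (A := block_mx 1%:M 0 0 S) (B := T)
         (A' := block_mx 1%:M 0 0 S') (B' := T')) hN => //; try exact: iD.
- by rewrite mul_diag_col mul_col_mx {1}eM.
- rewrite mul_diag_col mul_col_mx -!mulmxA eT mulmx1 {1}eM.
  by rewrite !mulmxA eS mul1mx -mulmxA eT mulmx1.
Qed.

(** The vector [g], dual to the kernel vector [f], is one more coordinate next to those of [T]. The
    order of [v] along [g] is the last exponent of [step_mx], and the part of [v] in the row space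
    of [M] can be replaced at will. *)
Lemma add_row_new m n (M : 'M[K]_(m, n)) rho p q (f : 'cV_n) (g v : 'rV_n) (u0 : 'rV_m) :
    has_orders M rho p -> nondec rho.+1 q ->
    (forall i, (i < rho)%N -> q i <= p i /\ p i <= q i.+1) ->
    imx f -> imx g -> M *m f = 0 -> g *m f = 1%:M ->
    v = u0 *m M + pi ^ (\sum_(i < rho.+1) q i - \sum_(i < rho) p i) *: g ->
  exists u : 'rV_m, has_orders (col_mx (v + u *m M) M) rho.+1 q.
Proof.
move=> [ndp [S [S' [T [T' [[iS iS'] [iT iT'] eS eT eM]]]]]] ndq qpq ifx ig Mf gf.
set e := (_ - _) => ev.
have Tf : T *m f = 0.
  have : S' *m M *m f = 0 by rewrite -mulmxA Mf mulmx0.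
  rewrite eM !mulmxA eS mul1mx -mulmxA => /(congr1 (mulmx (invmx (dg rho p)))).
  by rewrite mulmx0 mulKmx // dg_unit.
rewrite -addn1 in ndq *.
have hN : has_orders (step_mx rho (rho + 1) p q) (rho + 1) q.
  apply: step_mx_orders => // [|i ir|i]; first by rewrite addn1.
    by case: (qpq i ir).
  by rewrite addn1 ltnS => ir; case: (qpq i ir).
pose x : 'rV[K]_rho := \row_j pi ^ step_exp p q j.
have eN : step_mx rho (rho + 1) p q = block_mx x (pi ^ e)%:M (dg rho p) 0.
  congr col_mx; apply/matrixP => i j; rewrite !mxE; case: splitP => j' ej; rewrite !mxE ej //.
    by rewrite !ord1 eqxx mulr1n addn0.
  by rewrite ord1 addn0 ltn_eqF.
rewrite eN in hN.
(* The part [u0] of [v] is cancelled, and the first [rho] entries of the top row of [step_mx] take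
   its place. *)
exists (x *m invmx (dg rho p) *m S' - u0).
have -> : v + (x *m invmx (dg rho p) *m S' - u0) *m M = x *m T + pi ^ e *: g.
  rewrite mulmxBl ev addrCA [u0 *m M + _]addrC addrK; congr (_ + _).
  by rewrite {1}eM -!mulmxA (mulmxA S') eS mul1mx mulKmx // dg_unit.
have iD r r' (X : 'M_(r, r')) : imx X -> imx (block_mx 1%:M 0 0 X : 'M_(1 + _, 1 + _)).
  by move=> iX; apply: imx_block => //; [exact: imx1|exact: imx0|exact: imx0].
(* The correction along [f] makes [row_mx T2 f] a right inverse of [col_mx T g]. *)
pose T2 := T' - f *m (g *m T').
have MT2 : M *m T2 = M *m T' by rewrite mulmxBr (mulmxA M) Mf mul0mx subr0.
have TT2 : T *m T2 = 1%:M by rewrite mulmxBr (mulmxA T) Tf mul0mx subr0.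
have gT2 : g *m T2 = 0 by rewrite mulmxBr (mulmxA g) gf mul1mx subrr.
have iT2 : imx T2 by apply: imxD => //; apply: imxN; do ![apply: imxM => //].
apply: (has_orders_equiv (A := block_mx 1%:M 0 0 S) (B := col_mx T g)
         (A' := block_mx 1%:M 0 0 S') (B' := row_mx T2 f)) hN; try exact: iD.
- exact: imx_col.
- exact: imx_row.
- rewrite mulmx_block !mul1mx !mul0mx !mulmx0 !addr0 !add0r.
  by rewrite mul_block_col mul0mx addr0 -eM mul_scalar_mx.
- rewrite mul_diag_col mul_mx_row !mul_col_mx -!(mulmxA S') Mf MT2 mulmx0.
  rewrite !mulmxDl -!scalemxAl gT2 gf -!mulmxA TT2 Tf mulmx1 mulmx0 scaler0.
  rewrite addr0 add0r scalemx1 -block_mxEh.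
  have -> : S' *m (M *m T') = dg rho p.
    by rewrite {1}eM !mulmxA eS mul1mx -mulmxA eT mulmx1.
  by [].
Qed.

End Step.

(** * The valuation at infinity of the rational functions *)

Section Infinity.
Variable F : fieldType.
Local Notation K := (ratfun F).
Local Notation "x %:F" := (@tofrac {poly F} x).

(* An alias making every [size] below the same term, since [lia] compares
   atoms syntactically and [size] is reached through several structures. *)
Definition psize (a : {poly F}) : nat := size a.

Lemma psizeE (a : {poly F}) : size a = psize a. Proof. by []. Qed.

Lemma psize_gt0 (a : {poly F}) : a != 0 -> (0 < psize a)%N.
Proof. by rewrite size_poly_gt0. Qed.

Lemma psizeM (a b : {poly F}) :
  a != 0 -> b != 0 -> psize (a * b) = (psize a + psize b).-1.
Proof. exact: size_mul. Qed.

Lemma psizeD (a b : {poly F}) : (psize (a + b) <= maxn (psize a) (psize b))%N.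
Proof. exact: size_polyD. Qed.

Lemma psize_modp (a b : {poly F}) : b != 0 -> (psize (a %% b) < psize b)%N.
Proof. by rewrite /psize ltn_modp. Qed.

(** The boolean form over a pair lets [dinf] pick a fraction with [xchoose]. *)
Lemma ratfunP (x : K) :
  exists ab : {poly F} * {poly F}, (ab.2 != 0) && (x == ab.1%:F / ab.2%:F).
Proof.
elim/quotW: x => r; exists (frac r); rewrite denom_ratioP /=.
apply/eqP/(mulIf (x := (frac r).2%:F)); first by rewrite tofrac_eq0 denom_ratioP.
rewrite mulfVK ?tofrac_eq0 ?denom_ratioP //.
unlock tofrac; rewrite -[LHS]FracField.pi_mul; apply/eqmodP.
rewrite /= FracField.equivfE /FracField.mulf.
by rewrite !numden_Ratio ?(oner_neq0, mul1r, mulr1, denom_ratioP) // mulrC.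
Qed.

(** At a nonzero argument this is the degree of the denominator minus that of the numerator: the
    shifts by one in the two sizes cancel. *)
Definition dinf (x : K) : int :=
  let ab := xchoose (ratfunP x) in (psize ab.2)%:Z - (psize ab.1)%:Z.

Lemma ratfun_frac (x : K) : exists a b : {poly F}, b != 0 /\ x = a%:F / b%:F.
Proof. by have [[a b] /= /andP[b0 /eqP->]] := ratfunP x; exists a, b. Qed.

Lemma ratfun_frac0 (x : K) : x != 0 ->
  exists a b : {poly F}, [/\ a != 0, b != 0 & x = a%:F / b%:F].
Proof.
have [a [b [b0 ->]]] := ratfun_frac x; exists a, b; split=> //.
by apply: contraNneq H => ->; rewrite tofrac0 mul0r.
Qed.

Lemma dinf_frac (a b : {poly F}) : a != 0 -> b != 0 ->
  dinf (a%:F / b%:F) = (psize b)%:Z - (psize a)%:Z.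
Proof.
move=> a0 b0; rewrite /dinf; move: (xchooseP (ratfunP (a%:F / b%:F))).
case: (xchoose _) => n0 d0.
move: (n0 : {poly F}) (d0 : {poly F}) => {n0 d0} n d /= /andP[d0 /eqP e].
have {}e : a * d = n * b.
  apply/eqP; rewrite -tofrac_eq !tofracM; apply/eqP.
  have bF : b%:F != 0 by rewrite tofrac_eq0.
  have dF : d%:F != 0 by rewrite tofrac_eq0.
  by apply/eqP; move: (eqr_div a%:F n%:F bF dF) => <-; rewrite e eqxx.
have n0 : n != 0.
  by apply: contraNneq (mulf_neq0 a0 d0) => n0; rewrite e n0 mul0r.
have := congr1 psize e; rewrite /= !psizeM //.
move: (psize_gt0 a0) (psize_gt0 b0) (psize_gt0 d0) (psize_gt0 n0); lia.
Qed.

Lemma dinf_poly (a : {poly F}) : a != 0 -> dinf a%:F = 1 - (psize a)%:Z.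
Proof.
move=> a0; have := dinf_frac a0 (oner_neq0 _).
by rewrite tofrac1 divr1 /psize size_poly1.
Qed.

Lemma dinfM (x y : K) : x != 0 -> y != 0 -> dinf (x * y) = dinf x + dinf y.
Proof.
move=> /ratfun_frac0[a [b [a0 b0 ->]]] /ratfun_frac0[c [d [c0 d0 ->]]].
rewrite mulrACA -invfM -!tofracM !dinf_frac ?mulf_neq0 // !psizeM //.
move: (psize_gt0 a0) (psize_gt0 b0) (psize_gt0 c0) (psize_gt0 d0); lia.
Qed.

Lemma dinfD (t : int) (x y : K) : x != 0 -> y != 0 -> x + y != 0 ->
  t <= dinf x -> t <= dinf y -> t <= dinf (x + y).
Proof.
move=> /ratfun_frac0[a [b [a0 b0 ->]]] /ratfun_frac0[c [d [c0 d0 ->]]].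
have bF : b%:F != 0 by rewrite tofrac_eq0.
have dF : d%:F != 0 by rewrite tofrac_eq0.
have -> : a%:F / b%:F + c%:F / d%:F = (a * d + c * b)%:F / (b * d)%:F.
  rewrite (addf_div a%:F c%:F bF dF) (tofracD (a * d)).
  by rewrite (tofracM a d) (tofracM c b) (tofracM b d).
have [E|n0] := eqVneq (a * d + c * b) 0.
  by rewrite E tofrac0 mul0r eqxx => /negP h; case: (h isT).
move=> _; rewrite !dinf_frac ?mulf_neq0 // psizeM //.
have := psizeD (a * d) (c * b); rewrite !psizeM //.
move: (psize_gt0 a0) (psize_gt0 b0) (psize_gt0 c0) (psize_gt0 d0).
move: (psize (a * d + c * b)) (psize a) (psize b) (psize c) (psize d).
clear; lia.
Qed.

Lemma sinv_neq0 : ('X%:F : K)^-1 != 0.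
Proof. by rewrite invr_eq0 tofrac_eq0 polyX_eq0. Qed.

Lemma dinf_sinv : dinf ('X%:F)^-1 = 1.
Proof.
have := @dinf_frac 1 'X (oner_neq0 _) (negbT (polyX_eq0 F)).
by rewrite tofrac1 div1r /psize size_poly1 size_polyX.
Qed.

Definition vinf : dvaluation K := DValuation dinfM dinfD sinv_neq0 dinf_sinv.

Lemma tofrac_polyXn n : ('X^n)%:F = (unif vinf) ^ (- n%:Z).
Proof. by rewrite tofracXn /= -invr_expz -exprnP exprVn invrK. Qed.

Lemma vge_poly t (a : {poly F}) : vge vinf (- t%:Z) a%:F = (size a <= t.+1)%N.
Proof.
have [->|a0] := eqVneq a 0; first by rewrite tofrac0 vge0 size_poly0.
rewrite vgeE ?tofrac_eq0 //= dinf_poly // psizeE.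
move: (psize_gt0 a0); lia.
Qed.

Lemma proper_vge (x : K) : Defs.proper x <-> vge vinf 0 x.
Proof.
split=> [[a [b [b0 sab ->]]]|].
  have [->|a0] := eqVneq a 0; first by rewrite tofrac0 mul0r vge0.
  rewrite vgeE /=; last by rewrite mulf_neq0 ?invr_eq0 ?tofrac_eq0.
  rewrite dinf_frac //; rewrite !psizeE in sab; lia.
have [->|x0] := eqVneq x 0.
  by exists 0, 1; rewrite oner_neq0 size_poly0 tofrac0 mul0r.
have [a [b [a0 b0 ->]]] := ratfun_frac0 x0.
rewrite vgeE /=; last by rewrite mulf_neq0 ?invr_eq0 ?tofrac_eq0.
rewrite dinf_frac // => h; exists a, b; split=> //; rewrite !psizeE; lia.
Qed.

Lemma proper_imx m n (A : 'M[K]_(m, n)) : proper_mx A <-> imx vinf A.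
Proof. by split=> h i j; apply/proper_vge; exact: h. Qed.

Lemma biproper_iunit n (B : 'M[K]_n) : biproper B <-> iunit vinf B.
Proof.
by split=> -[/proper_imx iB [B' [/proper_imx iB' h h']]]; split=> //; exists B'.
Qed.

(** Division with remainder: the remainder over the denominator is strictly proper. *)
Lemma poly_part (x : K) : exists a : {poly F}, vge vinf 1 (x - a%:F).
Proof.
have [n [d [d0 ->]]] := ratfun_frac x; exists (n %/ d).
have dF : d%:F != 0 by rewrite tofrac_eq0.
rewrite {1}(divp_eq n d) tofracD tofracM mulrDl mulfK // addrAC subrr add0r.
have [->|r0] := eqVneq (n %% d) 0; first by rewrite tofrac0 mul0r vge0.
rewrite vgeE /=; last by rewrite mulf_neq0 ?invr_eq0 ?tofrac_eq0.
rewrite dinf_frac //; have := psize_modp n d0; lia.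
Qed.

(** The residue field at infinity is [F]: the polynomial part of a proper function is proper, hence
    constant. *)
Lemma residue (x : K) : vge vinf 0 x -> exists c : F, vge vinf 1 (x - c%:P%:F).
Proof.
move=> x0; have [a ha] := poly_part x; exists a`_0.
have : vge vinf 0 a%:F.
  have -> : a%:F = x + - (x - a%:F) by rewrite opprB addrC subrK.
  by apply: (vgeD x0); apply: vgeN; exact: (vgeW ler01 ha).
rewrite -[0]oppr0 (vge_poly 0) => /size1_polyC {1}<-; exact: ha.
Qed.

Lemma poly_part_mx m n (A : 'M[K]_(m, n)) :
  exists P : 'M[{poly F}]_(m, n), forall i j, vge vinf 1 ((A - ratmx P) i j).
Proof.
have h ij : exists a : {poly F}, vge vinf 1 (A ij.1 ij.2 - a%:F) by exact: poly_part.
have [g hg] := fin_all_exists h.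
exists (\matrix_(i, j) g (i, j)) => i j; rewrite !mxE; exact: hg (i, j).
Qed.

Lemma smith_infty_smith m n (p : seq int) :
  smith_infty F m n p = smith vinf m n (size p) (fun i => p`_i).
Proof.
apply/matrixP => i j; rewrite !mxE; case: andP => // -[_ _].
by rewrite /= exprz_inv.
Qed.

(** From right to left, [smith_exists] provides a form with square multipliers and uniqueness
    identifies its exponents. *)
Lemma invariant_ordersP m n (R : 'M[K]_(m, n)) (p : seq int) :
  invariant_orders_at_infinity R p <-> has_orders vinf R (size p) (fun i => p`_i).
Proof.
split=> [[sp srt [B1 [B2 [/biproper_iunit u1 /biproper_iunit u2 E]]]]|hR].
  rewrite smith_infty_smith in E; apply: smith_orders u1 u2 E.
  - by rewrite sp rank_leq_row.
  - by rewrite sp rank_leq_col.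
  - move=> i j ij jr; apply: (sorted_leq_nth le_trans le_refl) => //.
    by rewrite inE (leq_ltn_trans ij).
have [r [q [B1 [B2 [rm rn ndq [u1 u2] E]]]]] := smith_exists vinf R.
have [er eq] := has_orders_uniq hR (smith_orders rm rn ndq u1 u2 E).
split; first by rewrite (has_orders_rank hR).
  apply/(sortedP 0) => i isz; case: hR => [ndp _]; exact: ndp.
exists B1, B2; split; try exact/biproper_iunit.
rewrite E smith_infty_smith er; apply/matrixP => i j; rewrite !mxE.
by case: andP => // -[_ ir]; rewrite eq // er.
Qed.

Lemma ratmxM m n l (A : 'M[{poly F}]_(m, n)) (B : 'M_(n, l)) :
  ratmx (A *m B) = ratmx A *m ratmx B.
Proof. exact: map_mxM. Qed.

Lemma ratmxD m n (A B : 'M[{poly F}]_(m, n)) : ratmx (A + B) = ratmx A + ratmx B.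
Proof. exact: map_mxD. Qed.

Lemma ratmxB m n (A B : 'M[{poly F}]_(m, n)) : ratmx (A - B) = ratmx A - ratmx B.
Proof. exact: map_mxB. Qed.

Lemma ratmx0 m n : ratmx (0 : 'M[{poly F}]_(m, n)) = 0.
Proof. exact: map_mx0. Qed.

Lemma ratmx1 n : ratmx (1%:M : 'M[{poly F}]_n) = 1%:M.
Proof. exact: map_mx1. Qed.

Lemma ratmx_col m1 m2 n (A : 'M[{poly F}]_(m1, n)) (B : 'M_(m2, n)) :
  ratmx (col_mx A B) = col_mx (ratmx A) (ratmx B).
Proof. exact: map_col_mx. Qed.

Lemma ratmx_inj m n : injective (@ratmx F m n).
Proof.
move=> A B /matrixP e; apply/matrixP => i j; have := e i j.
by rewrite !mxE => /eqP; rewrite tofrac_eq => /eqP.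
Qed.

Lemma ratmx_det n (A : 'M[{poly F}]_n) : \det (ratmx A) = (\det A)%:F.
Proof. exact: det_map_mx. Qed.

(* Only the class of u modulo integral row vectors matters, and every class
   has a polynomial representative. *)
Lemma has_orders_poly_row m n (M : 'M[{poly F}]_(m, n)) (w : 'rV_n) (u : 'rV_m) r q :
  has_orders vinf (col_mx (ratmx w + u *m ratmx M) (ratmx M)) r q ->
  exists a : 'rV_m, has_orders vinf (ratmx (col_mx (w + a *m M) M)) r q.
Proof.
move=> H; have [a ha] := poly_part_mx u; exists a.
have iD : imx vinf (u - ratmx a) by move=> i j; apply: vgeW (ha i j).
have bl : forall d : 'rV_m, block_mx 1%:M d 0 1%:M *m col_mx (ratmx w + u *m ratmx M) (ratmx M)
    = col_mx (ratmx w + (u + d) *m ratmx M) (ratmx M).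
  by move=> d; rewrite mul_block_col !mul1mx mul0mx add0r mulmxDl addrA.
have E : ratmx (col_mx (w + a *m M) M) =
    block_mx 1%:M (- (u - ratmx a)) 0 1%:M *m col_mx (ratmx w + u *m ratmx M) (ratmx M).
  have ea : u - (u - ratmx a) = ratmx a by rewrite opprB addrC subrK.
  by rewrite bl ea ratmx_col ratmxD ratmxM.
have iB (d : 'rV_m) : imx vinf d -> imx vinf (block_mx 1%:M d 0 1%:M).
  by move=> id; apply: imx_block => //; [exact: imx1|exact: imx0|exact: imx1].
apply: (has_orders_equiv (A := block_mx 1%:M (- (u - ratmx a)) 0 1%:M) (B := 1%:M)
  (A' := block_mx 1%:M (u - ratmx a) 0 1%:M) (B' := 1%:M)) H; try exact: imx1.
- by apply: iB; apply: imxN.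
- exact: iB.
- by rewrite mulmx1.
- rewrite mulmx1 E mulmxA mulmx_block !mulmx1 !mul1mx !mul0mx !mulmx0 !addr0 add0r.
  by rewrite addNr -scalar_mx_block mul1mx.
Qed.

End Infinity.

(** * Minimal bases *)

Section MinimalBasis.
Variable F : fieldType.
Local Notation K := (ratfun F).

Definition cols_mx n d (X : seq 'cV[{poly F}]_n) : 'M[{poly F}]_(n, d) :=
  \matrix_(i, j) (X`_j) i ord0.

Lemma mul_cols_mx n d (X : seq 'cV[{poly F}]_n) (u : 'cV[K]_d) : size X = d ->
  ratmx (cols_mx d X) *m u = \sum_(j < d) u j ord0 *: [seq ratmx v | v <- X]`_j.
Proof.
move=> sX; apply/matrixP => i j; rewrite ord1 mxE summxE; apply: eq_bigr => k _.
by rewrite (nth_map 0) ?sX ?ltn_ord // !mxE mulrC.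
Qed.

Lemma cols_mx_basis n d (U : {vspace 'cV[K]_n}) (X : seq 'cV[{poly F}]_n) :
  size X = d -> \dim U = d ->
  (forall j, (j < d)%N -> ratmx X`_j \in U) ->
  (forall u : 'cV[K]_d, ratmx (cols_mx d X) *m u = 0 -> u = 0) ->
  polynomial_basis U X.
Proof.
move=> sX dU XU Xfree; rewrite /polynomial_basis basisEfree size_map sX dU leqnn andbT.
apply/andP; split; last first.
  by apply/span_subvP => _ /mapP[v vX ->]; rewrite -(nth_index 0 vX) XU // -sX index_mem.
have st : size [seq ratmx v | v <- X] == d by rewrite size_map sX.
apply/(freeP (X := Tuple st)) => k /= k0 i.
have /Xfree/matrixP/(_ i ord0) : ratmx (cols_mx d X) *m (\col_j k j) = 0.
  by rewrite mul_cols_mx // -[RHS]k0; apply: eq_bigr => j _; rewrite mxE.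
by rewrite !mxE.
Qed.

(** The columns of [N] are a minimal basis of the kernel. The last clause is the exchange property
    through which minimality enters later: a smaller [w] involving column [i] could replace that
    column. *)
Lemma minimal_basis_mx m n d (P : 'M[{poly F}]_(m, n)) (c : seq nat) :
  column_minimal_indices (ratmx P) c -> size c = d ->
  exists N : 'M[{poly F}]_(n, d),
  [/\ ratmx P *m ratmx N = 0,
      forall v : 'cV[K]_n, ratmx P *m v = 0 -> exists u, v = ratmx N *m u,
      forall u : 'cV[K]_d, ratmx N *m u = 0 -> u = 0,
      forall i j, (size (N i j) <= (nth 0 c j).+1)%N
    & forall (u : 'cV[K]_d) (w : 'cV[{poly F}]_n) i,
        ratmx N *m u = ratmx w -> u i ord0 != 0 ->
        ~ forall l, (size (w l ord0) <= nth 0 c i)%N].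
Proof.
move=> [srt [X0 [bX0 minX0] pc]] sc.
(* The basis is sorted by decreasing degree to match the order of [c]. *)
have [X [pX cX]] : exists X : seq 'cV[{poly F}]_n, perm_eq X X0 /\ c = [seq vdeg v | v <- X].
  exists (sort (relpre (@vdeg F n) geq) X0); split; first by rewrite perm_sort.
  have geq_anti : antisymmetric geq.
    by move=> a b /andP[/= ab ba]; apply/eqP; rewrite eqn_leq ab ba.
  have geq_trans : transitive geq by move=> a b e /= ab bc; exact: leq_trans bc ab.
  apply: (sorted_eq geq_trans geq_anti srt).
    by rewrite sorted_map; apply: sort_sorted => a b; exact: leq_total.
  by rewrite (perm_trans pc) // perm_map // perm_sym perm_sort.
have bX : polynomial_basis (right_kernel (ratmx P)) X.
  by rewrite /polynomial_basis (perm_basis _ (perm_map _ pX)).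
have minX Y : polynomial_basis (right_kernel (ratmx P)) Y ->
    (\sum_(v <- X) vdeg v <= \sum_(v <- Y) vdeg v)%N.
  by move=> /minX0; rewrite (perm_big _ pX).
have sX : size X = d by rewrite -sc cX size_map.
have nc j : (j < d)%N -> nth 0 c j = vdeg X`_j.
  by move=> jd; rewrite cX (nth_map 0) // sX.
have st : size [seq ratmx v | v <- X] == d by rewrite size_map sX.
have XU j : (j < d)%N -> ratmx X`_j \in right_kernel (ratmx P).
  move=> jd; rewrite -(span_basis bX) memv_span //.
  by rewrite map_f // mem_nth // sX.
have Xspan (v : 'cV[K]_n) : ratmx P *m v = 0 -> exists u, v = ratmx (cols_mx d X) *m u.
  move=> Pv; have : v \in right_kernel (ratmx P) by rewrite mem_right_kernel; apply/eqP.
  rewrite -(span_basis bX) => /(coord_span (X := Tuple st)) Ev; rewrite {1}Ev.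
  exists (\col_j coord (Tuple st) j v); rewrite mul_cols_mx //.
  by apply: eq_bigr => j _; rewrite mxE.
have Xfree (u : 'cV[K]_d) : ratmx (cols_mx d X) *m u = 0 -> u = 0.
  rewrite mul_cols_mx // => u0; apply/colP => j; rewrite mxE.
  exact: (freeP (X := Tuple st) (basis_free bX) (fun j => u j ord0) u0 j).
exists (cols_mx d X); split=> //.
- apply/matrixP => i j; move: (XU j (ltn_ord j)); rewrite mem_right_kernel.
  move=> /eqP/matrixP/(_ i ord0); rewrite !mxE => e; rewrite -[RHS]e.
  by apply: eq_bigr => l _; rewrite !mxE.
- move=> i j; rewrite mxE nc //; have := leq_bigmax (F := fun i => (size (X`_j i ord0)).-1) i.
  by rewrite -/(vdeg _); case: (size _).
move=> u w i Nu ui wsmall.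
(* [w] replaces column [i]; the result is still a basis because [u i] is nonzero. *)
pose Y := mkseq (fun j => if j == i then w else X`_j) d.
have Ynth j : (j < d)%N -> Y`_j = if j == i then w else X`_j by move=> jd; rewrite nth_mkseq.
have sY : size Y = d by rewrite size_mkseq.
have wU : ratmx w \in right_kernel (ratmx P).
  rewrite -Nu mul_cols_mx // memv_suml // => j _; rewrite memvZ //.
  by rewrite (nth_map 0) ?sX // XU.
have bY : polynomial_basis (right_kernel (ratmx P)) Y.
  apply: (cols_mx_basis sY).
  - by rewrite (size_basis (X := Tuple st) bX) .
  - by move=> j jd; rewrite Ynth //; case: eqP => // _; exact: XU.
  move=> k k0.
  have /Xfree/matrixP z : ratmx (cols_mx d X) *m
      (\col_j (if j == i then 0 else k j ord0) + k i ord0 *: u) = 0.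
    rewrite mulmxDr -scalemxAr Nu -[RHS]k0 !mul_cols_mx // [RHS](bigD1 i) //=.
    rewrite [X in X + _](bigD1 i) //= !mxE eqxx scale0r add0r addrC; congr (_ + _); last first.
      by rewrite (nth_map 0) ?sY // Ynth // eqxx.
    apply: eq_bigr => j ji; rewrite mxE (negPf ji).
    have jY : (j < size Y)%N by rewrite sY.
    have jX : (j < size X)%N by rewrite sX.
    rewrite (nth_map 0 0 _ jX) (nth_map 0 0 _ jY) Ynth //.
    by rewrite -val_eqE /= in ji; rewrite (negPf ji).
  have ki : k i ord0 = 0.
    have := z i ord0; rewrite !mxE eqxx add0r => /eqP.
    by rewrite mulf_eq0 (negPf ui) orbF => /eqP.
  apply/colP => j; have := z j ord0; rewrite !mxE ki mul0r addr0.
  by case: eqP => [-> _|_ h]; [exact: ki|exact: h].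
have := minX _ bY; rewrite !(big_nth (0 : 'cV[{poly F}]_n)) sX sY !big_mkord.
rewrite (bigD1 i) //= [leqRHS](bigD1 i) //= Ynth // eqxx.
have -> : (\sum_(j < d | j != i) vdeg Y`_j = \sum_(j < d | j != i) vdeg X`_j)%N.
  apply: eq_bigr => j ji; rewrite Ynth //.
  by rewrite -val_eqE /= in ji; rewrite (negPf ji).
rewrite leq_add2r -nc // => cw.
have w0 : w != 0.
  apply: contraNneq ui => w0; rewrite (Xfree u) ?mxE // Nu w0 ratmx0 //.
have [l wl] : exists l, w l ord0 != 0.
  by have [l [j]] := matrix0Pn _ w0; rewrite ord1; exists l.
(* [vdeg] truncates at 0, so a size at most [c_i] gives a degree below [c_i] only once [c_i] is
   positive. *)
have ci : (0 < nth 0 c i)%N by apply: leq_trans (wsmall l); rewrite size_poly_gt0.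
move: cw; rewrite leqNgt => /negP; apply; rewrite -(ltn_predK ci) ltnS.
apply/bigmax_leqP => l' _; have := wsmall l'.
by case: (nth _ _ _) ci => // a _ ; case: (size _) => // b; rewrite ltnS.
Qed.

End MinimalBasis.

(** * Polynomial and proper left inverses of a minimal basis *)

Section LeftInverses.
Variable F : fieldType.
Local Notation K := (ratfun F).
Local Notation "x %:F" := (@tofrac {poly F} x).
Local Notation pi := (unif (vinf F)).
Local Notation vge := (vge (vinf F)).
Local Notation imx := (imx (vinf F)).

Lemma vge_size k (a : {poly F}) : vge (1 - k%:Z) a%:F = (size a <= k)%N.
Proof.
have [->|a0] := eqVneq a 0; first by rewrite tofrac0 vge0 size_poly0.
by rewrite vgeE ?tofrac_eq0 //= dinf_poly // psizeE; lia.
Qed.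

(** The cofactors along row [j] do not see that row, so they are those of the identity. *)
Lemma det_row_replace (R : comNzRingType) n (j : 'I_n) (v : 'rV[R]_n) :
  \det (\matrix_(a, b) if a == j then v ord0 b else (a == b)%:R) = v ord0 j.
Proof.
have adj1 : \adj (1%:M : 'M[R]_n) = 1%:M by rewrite -[LHS]mul1mx mul_mx_adj det1.
rewrite (expand_det_row _ j) (bigD1 j) //= mxE eqxx.
have cof l : cofactor (\matrix_(a, b) if a == j then v ord0 b else (a == b)%:R) j l
    = (l == j)%:R.
  have := congr1 (fun A : 'M[R]_n => A l j) adj1; rewrite !mxE => <-.
  congr (_ * \det _); apply/matrixP => a b; rewrite !mxE.
  by rewrite eq_sym (negPf (neq_lift _ _)).
rewrite cof eqxx mulr1 big1 ?addr0 // => l lj.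
by rewrite cof (negPf lj) mulr0.
Qed.

Section MinimalMatrix.
Variables (n d : nat) (N : 'M[{poly F}]_(n, d)) (c : seq nat).
Hypothesis Nfree : forall u : 'cV[K]_d, ratmx N *m u = 0 -> u = 0.
Hypothesis Nsize : forall i j, (size (N i j) <= (nth 0 c j).+1)%N.
Hypothesis Nexchange : forall (u : 'cV[K]_d) (w : 'cV[{poly F}]_n) i,
  ratmx N *m u = ratmx w -> u i ord0 != 0 ->
  ~ forall l, (size (w l ord0) <= nth 0 c i)%N.

(** If the strictly proper part [u'] of [u] were nonzero, [N u'] would be a polynomial vector of
    degree below the largest index involved, against the exchange property. *)
Lemma minimal_mx_saturated (u : 'cV[K]_d) (w : 'cV_n) :
  ratmx N *m u = ratmx w -> exists v, u = ratmx v.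
Proof.
move=> Nu; have [v hv] := poly_part_mx u; exists v.
pose u' := u - ratmx v; apply/eqP; rewrite -subr_eq0 -/u'; apply/negPn/negP => u'0.
have Nu' : ratmx N *m u' = ratmx (w - N *m v) by rewrite mulmxBr Nu ratmxB ratmxM.
have [i0 [j0]] := matrix0Pn _ u'0; rewrite ord1 => nz0.
case: (arg_maxnP (P := fun i => u' i ord0 != 0) (fun i => nth 0%N c i) nz0) => i ui hi.
apply: (Nexchange Nu' ui) => l; rewrite -vge_size.
have -> : ((w - N *m v) l ord0)%:F = (ratmx N *m u') l ord0 by rewrite Nu' [RHS]mxE.
rewrite mxE; apply: vge_sum => j _.
have [->|uj] := eqVneq (u' j ord0) 0; first by rewrite mulr0 vge0.
apply: (vgeW (t := (1 - (nth 0%N c j).+1%:Z) + 1)); first by have := hi j uj; lia.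
by apply: vgeM; [rewrite mxE vge_size Nsize|exact: hv].
Qed.

Lemma minimal_mx_rank : \rank (ratmx N) = d.
Proof.
have : row_free (ratmx N)^T.
  apply: inj_row_free => v /(congr1 trmx); rewrite trmx_mul trmxK trmx0 => /Nfree.
  by move=> /(congr1 trmx); rewrite trmxK trmx0.
by rewrite -mxrank_tr => /eqP.
Qed.

(* Among the polynomial L with L N nonsingular, one whose determinant has
   least degree makes N (L N)^-1 polynomial: a nonzero strictly proper part of
   an entry could be swapped into L, lowering that degree. *)
Lemma minimal_mx_quotient : exists (L : 'M[{poly F}]_(d, n)) (H : 'M[{poly F}]_(n, d)),
  \det (L *m N) != 0 /\ ratmx N = ratmx H *m ratmx (L *m N).
Proof.
have [L0 dL0] : exists L : 'M[{poly F}]_(d, n), \det (L *m N) != 0.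
  have full : row_full (ratmx N) by rewrite /row_full minimal_mx_rank.
  have := fullrowsub_unit full; set f := fullrankfun full => uN.
  exists (rowsub f 1%:M); rewrite mul_rowsub_mx mul1mx -tofrac_eq0 -ratmx_det.
  have -> : ratmx (rowsub f N) = rowsub f (ratmx N) by exact: map_mxsub.
  by move: uN; rewrite unitmxE unitfE.
have [k] := ubnP (psize (\det (L0 *m N))).
elim: k L0 dL0 => // k IH L dL; rewrite ltnS => dLk.
set T := L *m N in dL dLk.
have uT : ratmx T \in unitmx by rewrite unitmxE unitfE ratmx_det tofrac_eq0.
have [H hH] := poly_part_mx (ratmx N *m invmx (ratmx T)).
set E := _ - _ in hH.
have ET : E *m ratmx T = ratmx (N - H *m T).
  by rewrite mulmxBl (mulmxKV uT) ratmxB ratmxM.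
have [E0|] := eqVneq E 0.
  exists L, H; split; first exact: dL.
  apply/eqP; rewrite -subr_eq0 -ratmxM -ratmxB -ET E0 mul0mx; exact: eqxx.
case/matrix0Pn => i [j Eij].
(* Row [j] of [L' *m N] becomes row [i] of [E *m T], which multiplies the determinant by [E i j], of
   positive valuation. *)
pose L' : 'M[{poly F}]_(d, n) :=
  \matrix_a (if a == j then delta_mx ord0 i - row i H *m L else row a L).
have L'T : ratmx (L' *m N) =
    (\matrix_(a, b) if a == j then row i E ord0 b else (a == b)%:R) *m ratmx T.
  apply/row_matrixP => a; rewrite row_mul.
  have -> : row a (ratmx (L' *m N)) = ratmx (row a L' *m N).
    by rewrite -row_mul; apply/rowP => b; rewrite !mxE.
  rewrite rowK; case: (eqVneq a j) => [->|aj].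
    rewrite mulmxBl -rowE -mulmxA -/T -(row_mul i H).
    have -> : row i N - row i (H *m T) = row i (N - H *m T).
      by apply/rowP => b; rewrite !mxE.
    have -> : ratmx (row i (N - H *m T)) = row i (E *m ratmx T).
      by rewrite ET; apply/rowP => b; rewrite !mxE.
    rewrite row_mul; congr (_ *m _); apply/rowP => b.
    by rewrite [RHS]mxE [RHS]mxE eqxx.
  have -> : ratmx (row a L *m N) = row a (ratmx T).
    by rewrite -row_mul; apply/rowP => b; rewrite !mxE.
  rewrite [row a (ratmx T)]rowE; congr (_ *m _); apply/rowP => b.
  by rewrite !mxE (negPf aj) eqxx eq_sym.
have dL' : (\det (L' *m N))%:F = E i j * (\det T)%:F.
  rewrite -ratmx_det L'T det_mulmx ratmx_det det_row_replace; congr (_ * _).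
  by rewrite mxE.
have TF0 : (\det T)%:F != 0 by rewrite tofrac_eq0.
have L'0 : \det (L' *m N) != 0 by rewrite -tofrac_eq0 dL'; exact: (mulf_neq0 Eij TF0).
apply: (IH L' L'0); apply: leq_trans dLk.
have : vge (1 + (1 - (psize (\det T))%:Z)) (\det (L' *m N))%:F.
  by rewrite dL'; apply: vgeM; [exact: hH|rewrite vge_size].
have -> : 1 + (1 - (psize (\det T))%:Z) = 1 - (psize (\det T)).-1%:Z.
  have := psize_gt0 dL; lia.
rewrite vge_size psizeE => h; apply: leq_ltn_trans h _.
by rewrite ltn_predL psize_gt0.
Qed.

(** [N T^-1] is the polynomial matrix [H], so [T^-1] is polynomial by saturation, and [T^-1 L] is a
    left inverse. *)
Lemma poly_left_inverse : exists L : 'M[{poly F}]_(d, n), L *m N = 1%:M.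
Proof.
have [L [H [dL EN]]] := minimal_mx_quotient; set T := L *m N in dL EN.
have uT : ratmx T \in unitmx by rewrite unitmxE unitfE ratmx_det tofrac_eq0.
have h j : exists v : 'cV[{poly F}]_d, col j (invmx (ratmx T)) = ratmx v.
  apply: (@minimal_mx_saturated _ (col j H)).
  rewrite colE mulmxA -colE EN (mulmxK uT); apply/colP => a; by rewrite !mxE.
have [g hg] := fin_all_exists h.
pose U : 'M[{poly F}]_d := \matrix_(a, b) g b a ord0.
have EU : ratmx U = invmx (ratmx T).
  apply/matrixP => a b; rewrite [LHS]mxE [U a b]mxE.
  by have /colP/(_ a) := hg b; rewrite [LHS]mxE [RHS]mxE => ->.
exists (U *m L); rewrite -mulmxA -/T; apply: ratmx_inj.
by rewrite ratmxM ratmx1 EU mulVmx.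
Qed.

Let cdg : 'M[K]_d := dg (vinf F) d (fun j => (nth 0%N c j)%:Z).

Lemma minimal_mx_proper : imx (ratmx N *m cdg).
Proof.
move=> i j; rewrite mul_dg mxE; have := Nsize i j; rewrite -vge_size => h.
have := vgeM h (vge_expu (vinf F) (lexx (nth 0%N c j)%:Z)).
by apply: vgeW; lia.
Qed.

(** A minimal basis is column reduced. If the residues [a] of [g] were not all zero, the combination
    of the columns with coefficients [a_l X^(c_i - c_l)], where [c_i] is the largest index involved,
    would have degree below [c_i], against the exchange property. *)
Lemma minimal_mx_leading (g : 'cV[K]_d) : imx g ->
  (forall i j, vge 1 ((ratmx N *m cdg *m g) i j)) -> forall j, vge 1 (g j ord0).
Proof.
move=> ig hg; have h j : exists a : F, vge 1 (g j ord0 - a%:P%:F) by exact: residue.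
have [a ha] := fin_all_exists h.
suff a0 j : a j = 0 by move=> j; have := ha j; rewrite a0 polyC0 tofrac0 subr0.
apply/eqP/negPn/negP => aj.
case: (arg_maxnP (P := fun i => a i != 0) (fun i => nth 0%N c i) aj) => i ai hi.
pose v : 'cV[{poly F}]_d := \col_l ((a l)%:P * 'X^(nth 0%N c i - nth 0%N c l)).
pose A : 'cV[K]_d := \col_l (a l)%:P%:F.
have Ev : ratmx v = pi ^ (- (nth 0%N c i)%:Z) *: (cdg *m A).
  apply/colP => l; rewrite [RHS]mxE dg_mul !mxE tofracM tofrac_polyXn.
  have [->|al] := eqVneq (a l) 0; first by rewrite polyC0 tofrac0 mul0r !mulr0.
  rewrite mulrA -expuD mulrC; congr (_ ^ _ * _).
  have := hi l al; lia.
have vi : ratmx v i ord0 != 0.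
  by rewrite !mxE tofrac_eq0 subnn expr0 mulr1 polyC_eq0.
apply: (@Nexchange (ratmx v) (N *m v) i); [by rewrite ratmxM|exact: vi|].
move=> l; rewrite -vge_size.
have -> : ((N *m v) l ord0)%:F = pi ^ (- (nth 0%N c i)%:Z) * (ratmx N *m cdg *m A) l ord0.
  have -> : ((N *m v) l ord0)%:F = ratmx (N *m v) l ord0 by rewrite [RHS]mxE.
  by rewrite ratmxM Ev -scalemxAr mulmxA [LHS]mxE.
rewrite vge_expuM opprK subrK.
have -> : A = g - (g - A) by rewrite opprB addrC subrK.
rewrite mulmxBr mxE; apply: vgeD; first exact: hg.
rewrite mxE; apply: vgeN; apply: vge_mulmx; first exact: minimal_mx_proper.
by move=> l' b; rewrite (ord1 b) mxE [(- A) _ _]mxE [A _ _]mxE; exact: ha.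
Qed.

(** All orders of the scaled basis are 0, so the integral factors of its Smith form already invert
    it. *)
Lemma proper_left_inverse : exists2 G : 'M[K]_(d, n), imx G & G *m (ratmx N *m cdg) = 1%:M.
Proof.
have [r [p hr]] := has_orders_exists (vinf F) (ratmx N *m cdg).
have er : r = d.
  by rewrite -(has_orders_rank hr) mxrankMfree ?minimal_mx_rank // row_free_unit dg_unit.
subst r; case: hr => [ndp [S [S' [T [T' [[iS iS'] [iT iT'] eS eT eM]]]]]].
have T'T : T' *m T = 1%:M by apply: mulmx1C.
have p0 (i : 'I_d) : p i = 0.
  apply/eqP; rewrite eq_le; apply/andP; split; last first.
    have : vge 0 ((S' *m (ratmx N *m cdg) *m T') i i).
      exact: (imxM (imxM iS' minimal_mx_proper) iT').
    rewrite eM !mulmxA eS mul1mx -mulmxA eT mulmx1 dgE !mxE eqxx mulr1n.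
    by rewrite vgeE ?expu_neq0 // dval_expu.
  rewrite leNgt; apply/negP => pi0.
  (* With [p i > 0], column [i] of [T'] has a strictly proper image, so it is strictly proper
     itself, which [T *m T' = 1] forbids. *)
  have h : forall l, vge 1 (col i T' l ord0).
    apply: minimal_mx_leading => [l b|l b]; first by rewrite mxE; exact: iT'.
    rewrite eM colE -!mulmxA (mulmxA T) eT mul1mx.
    apply: vge_mulmx; first exact: iS.
    move=> l' b'; rewrite dg_mul vge_expuM mxE.
    have [->|li] := eqVneq l' i; last by rewrite /=; exact: vge0.
    rewrite (ord1 b') /=; apply: (vgeW (t := 0)); last exact: vge1.
    by rewrite subr_le0.
  have : vge 1 ((T *m col i T') i ord0).
    apply: vge_mulmx; first exact: iT.
    by move=> l b; rewrite (ord1 b); exact: h.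
  rewrite colE mulmxA eT mul1mx mxE !eqxx vgeE ?oner_neq0 //.
  by rewrite dval1.
exists (T' *m S'); first exact: imxM.
have -> : T' *m S' *m (ratmx N *m cdg) = T' *m (S' *m S *m dg (vinf F) d p *m T).
  by rewrite eM !mulmxA.
rewrite eS mul1mx.
have -> : dg (vinf F) d p = 1%:M.
  by apply/matrixP => i j; rewrite dgE !mxE p0 expr0z.
by rewrite mul1mx T'T.
Qed.

End MinimalMatrix.
End LeftInverses.

(** * Necessity *)

Section Necessity.
Variable F : fieldType.
Local Notation K := (ratfun F).
Local Notation pi := (unif (vinf F)).
Local Notation imx := (imx (vinf F)).
Local Notation has_orders := (has_orders (vinf F)).
Local Notation dg := (dg (vinf F)).

Lemma unit_submx (L : fieldType) m n k (A : 'M[L]_(m, n)) : (k <= \rank A)%N ->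
  exists (f : 'I_k -> 'I_m) (g : 'I_k -> 'I_n), mxsub f g A \in unitmx.
Proof.
move=> kA; pose f i := maxrankfun A (widen_ord kA i); exists f.
have free : row_free (rowsub f A).
  have -> : rowsub f A = pid_mx k *m rowsub (maxrankfun A) A.
    apply/row_matrixP => i; rewrite row_rowsub row_mul.
    have -> : row i (pid_mx k : 'M[L]_(k, \rank A)) = delta_mx ord0 (widen_ord kA i).
      by apply/rowP => j; rewrite !mxE eqxx ltn_ord andbT -val_eqE eq_sym.
    by rewrite -rowE row_rowsub.
  by rewrite /row_free mxrankMfree ?maxrowsub_free // rank_pid_mx ?eqxx // kA.
have full : row_full (rowsub f A)^T by rewrite /row_full mxrank_tr.
exists (fullrankfun full); rewrite -unitmx_tr.
have -> : (mxsub f (fullrankfun full) A)^T = rowsub (fullrankfun full) (rowsub f A)^T.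
  by apply/matrixP => i j; rewrite !mxE.
exact: fullrowsub_unit.
Qed.

Lemma mul_copid (L : fieldType) m n b (A : 'M[L]_(m, n)) i j :
  (A *m copid_mx b) i j = if (j < b)%N then 0 else A i j.
Proof.
have pE : (A *m pid_mx b) i j = if (j < b)%N then A i j else 0.
  rewrite mxE (bigD1 j) //= mxE eqxx big1 ?addr0 => [|l].
    by case: (j < b)%N; rewrite ?mulr1 ?mulr0.
  by rewrite mxE -val_eqE /= => /negPf->; rewrite mulr0.
rewrite /copid_mx mulmxBr mulmx1 mxE [X in _ + X]mxE pE.
by case: ifP; rewrite ?subrr ?subr0.
Qed.

(** The entry at position [l] of a strictly increasing list bounded below by [b] is at least
    [b + l], and [c] is nonincreasing. *)
Lemma sum_sorted_le (c : nat -> nat) b s :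
  (forall i j, (i <= j)%N -> (c j <= c i)%N) -> sorted ltn s -> all (leq b) s ->
  (\sum_(j <- s) c j <= \sum_(b <= i < b + size s) c i)%N.
Proof.
move=> nc; elim: s b => [|a s IH] b /=; first by rewrite big_nil.
move=> pas /andP[ba _]; rewrite big_cons addnS big_ltn ?ltnS ?leq_addr //.
rewrite -addSn; apply: leq_add; first exact: nc.
apply: IH; first exact: path_sorted pas.
have /allP h := order_path_min ltn_trans pas.
by apply/allP => j /h aj; apply: leq_ltn_trans aj.
Qed.

Lemma sum_inj_le (c : nat -> nat) b k d (g : 'I_k -> 'I_d) :
  (forall i j, (i <= j)%N -> (c j <= c i)%N) -> injective g ->
  (forall l, (b <= g l)%N) ->
  (\sum_l c (g l) <= \sum_(b <= i < b + k) c i)%N.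
Proof.
move=> nc gI gb; pose s := sort leq [seq val (g l) | l <- enum 'I_k].
have ps : perm_eq s [seq val (g l) | l <- enum 'I_k] by rewrite perm_sort.
have -> : (\sum_l c (g l) = \sum_(j <- s) c j)%N.
  by rewrite (perm_big _ ps) big_map big_enum.
have sk : size s = k by rewrite (perm_size ps) size_map size_enum_ord.
rewrite -[X in (b + X)%N]sk.
apply: sum_sorted_le => //.
  rewrite ltn_sorted_uniq_leq sort_sorted; last exact: leq_total.
  rewrite andbT (perm_uniq ps) map_inj_uniq ?enum_uniq //.
  by move=> i j /val_inj/gI.
rewrite (perm_all _ ps); apply/allP => _ /mapP[l _ ->]; exact: gb.
Qed.

Lemma sorted_geq_nth c i j : sorted geq c -> (i <= j)%N -> (nth 0 c j <= nth 0 c i)%N.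
Proof.
move=> sc ij; have [jc|cj] := ltnP j (size c); last by rewrite [nth _ _ j]nth_default.
have tr : transitive geq by move=> a b e /= ab bc; exact: leq_trans bc ab.
have rf : reflexive geq by move=> a; exact: leqnn.
have h := sorted_leq_nth tr rf 0%N sc; have ic := leq_ltn_trans ij jc. exact: (h i j ic jc ij).
Qed.

Section Bounds.
Variables (m n r z x : nat) (P : 'M[{poly F}]_(m, n)) (W : 'M[{poly F}]_(z, n)).
Variables (p q : nat -> int).
Hypotheses (hP : has_orders (ratmx P) r p).
Hypotheses (hM : has_orders (ratmx (col_mx P W)) (r + x) q).

Lemma orders_le i : (i < r)%N -> q i <= p i.
Proof.
have E : ratmx P = row_mx 1%:M 0 *m ratmx (col_mx P W) *m 1%:M.
  by rewrite ratmx_col mul_row_col mul1mx mul0mx addr0 mulmx1.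
have iA : imx (row_mx 1%:M 0 : 'M_(m, m + z)).
  by apply: imx_row; [exact: imx1|exact: imx0].
have [_ h] := has_orders_le hP hM iA (@imx1 _ _ _) E; exact: h.
Qed.

(** The [z] conditions in [interlace] make the coefficients of the rows of [W] vanish. *)
Lemma orders_ge i : (i + z < r + x)%N -> p i <= q (i + z)%N.
Proof.
have iA : imx (col_mx 1%:M 0 : 'M_(m + z, m)).
  by apply: imx_col; [exact: imx1|exact: imx0].
move=> iz; have [] // := @interlace _ _ _ _ _ _ z _ _ (col_mx 0 1%:M) _ 1%:M
  _ _ _ _ i hM hP iA (@imx1 _ _ _) _ iz.
move=> u; rewrite -[u]hsubmxK mul_row_col mulmx0 mulmx1 add0r => ->.
by rewrite ratmx_col !mul_row_col mulmx1 mulmx0 mul0mx !addr0 mulmx1.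
Qed.

Variables (d : nat) (N : 'M[{poly F}]_(n, d)) (c : seq nat).
Hypotheses (PN : ratmx P *m ratmx N = 0) (Nrank : \rank (ratmx N) = d).
Hypotheses (nrd : (n = r + d)%N) (sc : sorted geq c).
Hypothesis (Nproper : imx (ratmx N *m dg d (fun j => (nth 0%N c j)%:Z))).

(** As [P N = 0], the rank of [W N] is that of [[P; W] N], and multiplying by [N] loses at most the
    dimension [n - d = r] of its left kernel. *)
Lemma rank_image : (x <= \rank (ratmx W *m ratmx N))%N.
Proof.
have := mxrank_mul_ker (ratmx (col_mx P W)) (ratmx N).
rewrite ratmx_col mul_col_mx PN -ratmx_col (has_orders_rank hM).
have -> : \rank (col_mx (0 : 'M_(m, d)) (ratmx W *m ratmx N)) = \rank (ratmx W *m ratmx N).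
  exact: rank_col_0mx.
have : (\rank (ratmx (col_mx P W) :&: kermx (ratmx N)) <= r)%N.
  rewrite (leq_trans (mxrankS (capmxSr _ _))) // mxrank_ker Nrank nrd addnK //.
lia.
Qed.

(* Keep k rows of W and k columns of N giving a nonzero minor of W N: the
   resulting square matrix Q has orders q2 with q_i <= q2_i, p_i <= q2_(i+k), and
   sum q2 - sum p is the valuation of a polynomial minor scaled by s^-c. *)
Lemma order_sum_le k : (k <= x)%N ->
  \sum_(i < r) Num.max (p i) (q (i + k)%N) + \sum_(i < k) q i - \sum_(i < r) p i
  <= (\sum_(x - k <= i < x) nth 0 c i)%N%:Z.
Proof.
move=> kx; set b := (x - k)%N.
pose A := ratmx W *m ratmx N.
(* Zeroing the first [b = x - k] columns of [A] lowers its rank, at least [x], by at most [b]. *)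
have [f [g]] : exists (f : 'I_k -> 'I_z) (g : 'I_k -> 'I_d),
    mxsub f g (A *m copid_mx b) \in unitmx.
  apply: unit_submx; have := mxrank_add (A *m pid_mx b) (A *m copid_mx b).
  rewrite -mulmxDr addrC subrK mulmx1.
  have := mxrankM_maxr A (pid_mx b : 'M_d); have := rank_image; rewrite -/A.
  have : (\rank (pid_mx b : 'M[K]_d) <= b)%N.
    have <- : (pid_mx b : 'M[K]_(d, b)) *m (pid_mx b : 'M_(b, d)) = pid_mx b.
      by rewrite mul_pid_mx !minnn.
    by rewrite (leq_trans (mxrankM_maxl _ _)) // rank_leq_col.
  move=> h1 h2 h3 h4; have := leq_trans h2 h4; have := leq_trans h3 h1; rewrite {h1 h2 h3 h4}.
  move: (\rank (A *m copid_mx b)) (\rank (A *m pid_mx b)) => y w; rewrite /b; lia.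
set B := mxsub f g _ => uB.
have detB : \det B != 0 by rewrite -unitfE -unitmxE.
have gb l : (b <= g l)%N.
  rewrite leqNgt; apply/negP => lb; case/negP: detB; apply/eqP.
  rewrite (expand_det_col _ l); apply: big1 => i _.
  by rewrite mxE mul_copid lb mul0r.
have eB : B = ratmx (mxsub f g (W *m N)).
  apply/matrixP => i l; rewrite [RHS]mxE [mxsub _ _ (W *m N) _ _]mxE mxE.
  rewrite mul_copid ltnNge gb.
  by rewrite /A -ratmxM [LHS]mxE.
have gI : injective g.
  move=> l l' e; apply/eqP/negPn/negP => ne; case/negP: detB; apply/eqP.
  rewrite -det_tr; apply: (determinant_alternate ne) => i.
  by rewrite !mxE e.
pose Dk : 'M[K]_k := diag_mx (\row_l pi ^ (nth 0%N c (g l))%:Z).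
pose Nk : 'M[K]_(n, k) := colsub g (ratmx N) *m Dk.
have iNk : imx Nk.
  move=> i l; have := Nproper i (g l); rewrite mul_dg /Nk mul_mx_diag !mxE; exact: id.
have PNk : ratmx P *m Nk = 0.
  rewrite mulmxA; suff -> : ratmx P *m colsub g (ratmx N) = 0 by rewrite mul0mx.
  apply/matrixP => i l; have /matrixP/(_ i (g l)) := PN; rewrite !mxE => h.
  by rewrite -[RHS]h; apply: eq_bigr => j _; rewrite !mxE.
case: (hP) => ndp [S [S' [T [T' [[iS iS'] [iT iT'] eS eT eP]]]]].
pose AQ : 'M[K]_(r + k, m + z) := block_mx S' 0 0 (rowsub f 1%:M).
pose BQ : 'M[K]_(n, r + k) := row_mx T' Nk.
pose Q : 'M[K]_(r + k) := block_mx (dg r p) 0 (rowsub f (ratmx W) *m T') (B *m Dk).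
have iAQ : imx AQ.
  apply: imx_block; [exact: iS'|exact: imx0|exact: imx0|].
  apply: imx_sub; exact: imx1.
have iBQ : imx BQ by apply: imx_row.
have EQ : Q = AQ *m ratmx (col_mx P W) *m BQ.
  rewrite ratmx_col mul_block_col !mul0mx addr0 add0r mul_rowsub_mx mul1mx.
  rewrite mul_col_row -[S' *m ratmx P *m Nk]mulmxA PNk mulmx0; congr (block_mx _ _ _ _).
    by rewrite eP !mulmxA eS mul1mx -mulmxA eT mulmx1.
  rewrite mulmxA; congr (_ *m _); rewrite eB; apply/matrixP => i l.
  rewrite [LHS]mxE [mxsub _ _ _ _ _]mxE.
  transitivity (ratmx (W *m N) (f i) (g l)); first by rewrite [RHS]mxE.
  by rewrite ratmxM !mxE; apply: eq_bigr => j _; rewrite !mxE.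
have dD : \det Dk = \prod_(l < k) pi ^ (nth 0%N c (g l))%:Z.
  by rewrite det_diag; apply: eq_bigr => l _; rewrite mxE.
have dD0 : \det Dk != 0 by rewrite dD; apply/prodf_neq0 => l _; exact: expu_neq0.
have dQ : \det Q = \det (dg r p) * (\det B * \det Dk) by rewrite det_lblock det_mulmx.
have dBD0 : \det B * \det Dk != 0 := mulf_neq0 detB dD0.
have dQ0 : \det Q != 0 by rewrite dQ; exact: (mulf_neq0 (det_dg_neq0 _ _ _) dBD0).
have [r' [q2 hQ]] := has_orders_exists (vinf F) Q.
have er : r' = (r + k)%N.
  by rewrite -(has_orders_rank hQ) mxrank_unit // unitmxE unitfE.
subst r'.
have [_ q_le] := has_orders_le hQ hM iAQ iBQ EQ.
(* The [k] conditions in [interlace] discard the last [k] rows of [Q], which leaves [dg r p]. *)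
have p_le i : (i < r)%N -> p i <= q2 (i + k)%N.
  move=> ir; have iA : imx (col_mx 1%:M 0 : 'M_(r + k, r)).
    by apply: imx_col; [exact: imx1|exact: imx0].
  have iB : imx (row_mx 1%:M 0 : 'M_(r, r + k)).
    by apply: imx_row; [exact: imx1|exact: imx0].
  have ik : (i + k < r + k)%N by rewrite ltn_add2r.
  have hD : has_orders (dg r p) r p by exact: has_orders_dg.
  have [] // := @interlace _ _ _ _ _ _ k _ _ (col_mx 0 1%:M) _ _ _ _ _ _ i hQ hD iA iB _ ik.
  move=> u; rewrite -[u]hsubmxK mul_row_col mulmx0 mulmx1 add0r => ->.
  rewrite /Q mul_row_block !mul0mx !addr0 mulmx0 mul_row_col mulmx1 mul0mx addr0.
  by rewrite mul_mx_row mulmx1 mulmx0.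
have [_ vQ] := has_orders_det hQ.
have vD : vinf F (\det (dg r p)) = \sum_(i < r) p i.
  by have [] := has_orders_det (has_orders_dg (vinf F) ndp).
have vDk : vinf F (\det Dk) = \sum_(l < k) (nth 0%N c (g l))%:Z.
  rewrite dD dval_prod => [|l _]; last exact: expu_neq0.
  by apply: eq_bigr => l _; rewrite dval_expu.
(* [det B] is a nonzero polynomial, so its order at infinity is at most 0. *)
have vB : vinf F (\det B) <= 0.
  rewrite eB ratmx_det /= in detB *; rewrite dinf_poly; last by rewrite -tofrac_eq0.
  have := @psize_gt0 _ (\det (mxsub f g (W *m N))).
  by rewrite -tofrac_eq0 => /(_ detB); move: (psize _) => s; clear; lia.
rewrite dQ (dvalM _ (det_dg_neq0 _ _ _) dBD0) (dvalM _ detB dD0) vD vDk in vQ.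
have c_le : \sum_(l < k) (nth 0%N c (g l))%:Z <= (\sum_(b <= i < x) nth 0%N c i)%N%:Z.
  have -> : x = (b + k)%N by rewrite /b subnK.
  rewrite -(big_morph Posz PoszD (erefl _)) lez_nat.
  by apply: (@sum_inj_le (nth 0%N c) b k d g) => // i j; exact: sorted_geq_nth.
have q_split : \sum_(i < r + k) q2 i = \sum_(i < k) q2 i + \sum_(i < r) q2 (i + k)%N.
  rewrite addnC big_split_ord /=; congr (_ + _); apply: eq_bigr => i _.
  by rewrite addnC.
have h1 : \sum_(i < k) q i <= \sum_(i < k) q2 i.
  by apply: ler_sum => i _; apply: q_le; rewrite ltn_addl.
have h2 : \sum_(i < r) Num.max (p i) (q (i + k)%N) <= \sum_(i < r) q2 (i + k)%N.
  by apply: ler_sum => i _; rewrite ge_max p_le //= q_le // ltn_add2r.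
rewrite q_split in vQ; move: vQ vB c_le h1 h2.
move: (vinf F (\det B)) (\sum_(l < k) (nth 0%N c (g l))%:Z) (\sum_(i < k) q i)
  (\sum_(i < k) q2 i) (\sum_(i < r) q2 (i + k)%N) (\sum_(i < r) p i)
  (\sum_(i < r) Num.max (p i) (q (i + k)%N)) (\sum_(b <= i < x) nth 0%N c i)%N.
clear; lia.
Qed.

End Bounds.
End Necessity.

(* lia does not identify big sums elaborated over different structures of int. *)
Ltac big_lia :=
  repeat match goal with H : context [@bigop.body _ _ _ _ _] |- _ => revert H end;
  repeat match goal with
  | |- context [@bigop.body ?R ?I ?x ?r ?f] => move: (@bigop.body R I x r f); intro
  end; lia.

(** * Polynomial matrices with prescribed triangular form at infinity *)

Section Triangular.
Variable F : fieldType.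
Local Notation K := (ratfun F).
Local Notation pi := (unif (vinf F)).
Local Notation imx := (imx (vinf F)).
Local Notation iunit := (iunit (vinf F)).
Local Notation dg := (dg (vinf F)).

(* Raise the terms of b one unit at a time; the unit goes to the first place
   where the constraint on partial sums is tight. *)
Lemma distribute n (delta : nat) (b f : nat -> int) :
    (forall i, (i.+1 < n)%N -> b i <= b i.+1) ->
    (forall i, (i.+1 < n)%N -> f i <= f i.+1) ->
    (forall k, (k <= n)%N -> \sum_(i < k) f i <= \sum_(i < k) b i + delta%:Z) ->
  exists b' : nat -> int,
  [/\ forall i, (i.+1 < n)%N -> b' i <= b' i.+1,
      forall i, (i < n)%N -> b i <= b' i,
      forall k, (k <= n)%N -> \sum_(i < k) b' i <= \sum_(i < k) b i + delta%:Z
    & forall k, (k <= n)%N -> \sum_(i < k) f i <= \sum_(i < k) b' i].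
Proof.
move=> sb sf; elim: delta b sb => [|delta IH] b sb h.
  by exists b; split=> // k kn; have := h k kn; rewrite addr0.
(* If the constraints hold with one unit less, that unit is not spent. *)
case: (boolP [forall k : 'I_n.+1, \sum_(i < k) f i <= \sum_(i < k) b i + delta%:Z]).
  move=> /forallP h'; have [|b' [h1 h2 h3 h4]] := IH b sb.
    by move=> k kn; have := h' (Ordinal (kn : (k < n.+1)%N)).
  exists b'; split=> // k kn; have := h3 k kn; big_lia.
rewrite negb_forall => /existsP[k1 hk1].
pose Q k := (k <= n)%N && (\sum_(i < k) b i + delta%:Z < \sum_(i < k) f i).
have exQ : exists k, Q k by exists k1; rewrite /Q -ltnS ltn_ord ltNge.
case: (ex_minnP exQ) => -[|k0] /andP[k0n Qk0] mink0.
  by rewrite !big_ord0 in Qk0; big_lia.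
have mink k : (k <= k0)%N -> \sum_(i < k) f i <= \sum_(i < k) b i + delta%:Z.
  move=> kk0; rewrite leNgt; apply/negP => hk.
  have := mink0 k; rewrite /Q hk andbT (leq_trans kk0 (ltnW k0n)) => /(_ isT).
  by rewrite ltnNge kk0.
(* The unit goes to [k0], where [k0.+1] is the first length at which [delta] units do not
   suffice. *)
pose b1 i := if i == k0 then b i + 1 else b i.
have sum_b1 k : \sum_(i < k) b1 i = \sum_(i < k) b i + (k0 < k)%N%:Z.
  elim: k => [|k IHk]; first by rewrite !big_ord0.
  rewrite !big_ord_recr /= IHk /b1 ltnS.
  by case: (ltngtP k0 k) => _ /=; big_lia.
have fk0 : b k0 + 1 <= f k0.
  have := mink k0 (leqnn _); have := Qk0; rewrite !big_ord_recr /=; big_lia.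
have [||b' [h1 h2 h3 h4]] := IH b1.
- move=> i i1n; rewrite /b1; case: (eqVneq i k0) => [e|ne]; last first.
    by case: eqP => _; have := sb i i1n; big_lia.
  (* Monotonicity at [k0]: the constraint at length [k0.+2] forces [f k0.+1 <= b k0.+1], while
     [b k0 + 1 <= f k0]. *)
  rewrite e -[k0.+1 == k0]negbK neq_ltn ltnSn orbT /=.
  have := h k0.+2; rewrite -e => /(_ i1n); have := sf i i1n; rewrite e.
  move: Qk0 fk0; rewrite !big_ord_recr /=; big_lia.
- move=> k kn; rewrite sum_b1; have [k0k|kk0] := ltnP k0 k.
    have := h k kn; big_lia.
  by have := mink k kk0; big_lia.
exists b'; split=> // [i ilt|k kn].
  by have := h2 i ilt; rewrite /b1; case: ifP => _; big_lia.
have := h3 k kn; rewrite sum_b1; case: (k0 < k)%N; big_lia.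
Qed.

Definition bidiag x (t : nat -> nat) : 'M[{poly F}]_x :=
  \matrix_(l, j) ((if l == j.+1 :> nat then 'X^(t j) else 0) - (l == j)%:R).

Lemma bidiag_unit x t : bidiag x t \in unitmx.
Proof.
rewrite unitmxE det_trig.
  rewrite (eq_bigr (fun=> -1)) => [|i _]; last by rewrite mxE eqxx ltn_eqF // sub0r.
  by rewrite prodr_const unitrX // unitrN unitr1.
apply/is_trig_mxP => i j ij; rewrite mxE -[i == j]val_eqE !ltn_eqF ?subr0 //.
exact: ltnW.
Qed.

(* Induction on x. The first row of Y is y = (X^(s_0), X^(s_1), ...) where
   s_j = s_(j+1) + t_j. The columns of bidiag t, except the last one, span the
   kernel of y, and their degrees relative to a are the b'_j provided by
   distribute; so the other rows of Y come from the solution for b'. *)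
Lemma triangular_exists x (a e : nat -> int) :
    (forall i, (i.+1 < x)%N -> a i <= a i.+1) ->
    (forall i, (i.+1 < x)%N -> e i <= e i.+1) ->
    (forall k, (k <= x)%N -> \sum_(i < k) e i <= \sum_(i < k) a i) ->
  exists (Y : 'M[{poly F}]_x) (B : 'M[K]_x),
  [/\ iunit B,
      forall k, (ratmx Y *m dg x a *m B) k k = pi ^ e k
    & forall k j : 'I_x, (k < j)%N -> (ratmx Y *m dg x a *m B) k j = 0].
Proof.
elim: x a e => [|x IH] a e sa se hae.
  by exists 0, 1%:M; split; [exact: iunit1|case|case].
have ea0 : e 0%N <= a 0%N by have := hae 1%N isT; rewrite !big_ord_recl !big_ord0 !addr0.
have [delta edelta] : exists delta : nat, a 0%N = e 0%N + delta%:Z.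
  by exists `|a 0%N - e 0%N|%N; lia.
have [|||b' [sb' bb' b'_le fb']] := @distribute x delta (fun i => a i.+1) (fun i => e i.+1).
- by move=> i ix; apply: sa.
- by move=> i ix; apply: se.
- move=> k kx; have := hae k.+1 kx; rewrite !big_ord_recl /=.
  under eq_bigr do rewrite /bump /= add1n.
  under [X in _ <= _ + X]eq_bigr do rewrite /bump /= add1n.
  by big_lia.
have [Y2 [B2 [uB2 Y2d Y2u]]] := IH b' (fun i => e i.+1) sb' (fun i ix => se i.+1 ix) fb'.
(* The exponents [s] start at [delta] and drop by [t i], the rise from [a i.+1] to [b' i]; the bound
   on the sums of [b'] keeps the truncated subtraction exact. *)
pose t i := `|b' i - a i.+1|%N.
pose s i := (delta - \sum_(j < i) t j)%N.
have tE i : (i < x)%N -> (t i)%:Z = b' i - a i.+1.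
  by move=> ix; have := bb' i ix; rewrite /t; lia.
have sum_t k : (k <= x)%N -> (\sum_(j < k) t j <= delta)%N.
  move=> kx; have : (\sum_(j < k) t j)%N%:Z = \sum_(j < k) b' j - \sum_(j < k) a j.+1.
    rewrite (big_morph Posz PoszD (erefl _)) -sumrB; apply: eq_bigr => j _.
    by apply: tE; apply: leq_trans kx.
  have := b'_le k kx; big_lia.
have sS i : (i < x)%N -> s i = (s i.+1 + t i)%N.
  by move=> ix; have := sum_t i.+1 ix; rewrite /s big_ord_recr /=; big_lia.
pose T := bidiag x.+1 t.
pose up (j : 'I_x) : 'I_x.+1 := lift ord_max j.
have upE j : up j = j :> nat by exact: lift_max.
pose T' := colsub up T.
have T'T l j : T' l j = T l (up j) by rewrite mxE.
pose y : 'rV[{poly F}]_x.+1 := \row_j 'X^(s j).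
have T'E l j : T' l j = (if l == j.+1 :> nat then 'X^(t j) else 0) - (l == j :> nat)%:R.
  by rewrite !mxE upE -val_eqE [val (up j)]upE.
clearbody T'.
have yT : y *m T' = 0.
  apply/rowP => j; rewrite !mxE.
  have j1 : (j < x.+1)%N by apply: ltnW; rewrite ltnS.
  have j2 : (j.+1 < x.+1)%N by rewrite ltnS.
  have pick (i : 'I_x.+1) (G : 'I_x.+1 -> {poly F}) :
      (forall l, l != i -> G l = 0) -> \sum_l G l = G i.
    by move=> h; rewrite (bigD1 i) //= big1 ?addr0.
  under eq_bigr do rewrite T'E mulrBr.
  rewrite sumrB (pick (Ordinal j2)) => [|l]; last first.
    by rewrite -val_eqE /= => /negPf->; rewrite mulr0.
  rewrite (pick (Ordinal j1)) => [|l]; last first.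
    by rewrite -val_eqE /= => /negPf->; rewrite mulr0.
  by rewrite !mxE /= !eqxx mulr1 -exprD -sS // subrr.
(* A zero column stands for the last column of [T], so that [Z T' = Y2]. *)
pose Y2e : 'M[{poly F}]_(x, x.+1) :=
  \matrix_(i, j) if unlift ord_max j is Some j' then Y2 i j' else 0.
pose Z := Y2e *m invmx T.
have ZT : Z *m T' = Y2.
  have E : Z *m T = Y2e by rewrite mulmxKV // bidiag_unit.
  apply/matrixP => i j; transitivity ((Z *m T) i (up j)).
    by rewrite !mxE; apply: eq_bigr => l _; rewrite T'T.
  by rewrite E mxE liftK.
(* [B1] turns [dg x.+1 a] into its first column followed by [T' *m dg x b']; it is integral since
   [a i <= a i.+1 <= b' i]. *)
pose B1 : 'M[K]_x.+1 := \matrix_(i, j)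
  ((i == j)%:R - (if j == i.+1 :> nat then pi ^ (b' i - a i) else 0)).
have uB1 : iunit B1.
  have iB1 : imx B1.
    move=> i j; rewrite mxE; apply: vgeD; first by case: (i == j); [exact: vge1|exact: vge0].
    apply: vgeN; case: eqP => [e1|_]; last exact: vge0.
    have ix : (i < x)%N by rewrite -ltnS -e1 ltn_ord.
    apply: vge_expu; have := bb' i ix; have := sa i ix; lia.
  have dB1 : \det B1 = 1.
    rewrite -det_tr det_trig; last first.
      apply/is_trig_mxP => i j ij; rewrite !mxE -[j == i]val_eqE /= (gtn_eqF ij).
      by rewrite (ltn_eqF (leqW ij)) subr0.
    by apply: big1 => i _; rewrite !mxE eqxx ltn_eqF // subr0.
  split=> //; exists (invmx B1).
  have uB : B1 \in unitmx by rewrite unitmxE dB1 unitr1.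
  split; [|exact: mulmxV|exact: mulVmx].
  by apply: imx_inv; rewrite ?dB1 ?oner_eq0 ?dval1.
exists (col_mx y Z : 'M_(1 + x, x.+1)), (B1 *m (block_mx 1%:M 0 0 B2 : 'M_(1 + x, 1 + x))).
have E1 : dg x.+1 a *m B1 =
    (row_mx (pi ^ a 0%N *: delta_mx ord0 ord0) (ratmx T' *m dg x b') : 'M_(x.+1, 1 + x)).
  apply/matrixP => l j; rewrite dg_mul [B1 _ _]mxE [RHS]mxE.
  case: splitP => j' ej.
    have -> : j = ord0 by apply: val_inj; rewrite /= ej ord1.
    rewrite !mxE ord1 eqxx andbT subr0.
    by case: eqP => [->|_]; rewrite ?mulr0.
  rewrite mul_dg mxE T'E -[l == j]val_eqE [val j]ej ej add1n eqSS.
  have jx := ltn_ord j'.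
  case: (ltngtP l j') => [lj|lj|elj].
  - by rewrite ltn_eqF ?subrr ?mulr0 ?mul0r ?tofrac0 ?mul0r // leqW.
  - rewrite !subr0; case: eqP => [->|_]; last by rewrite mulr0 tofrac0 mul0r.
    rewrite mulr1 tofrac_polyXn -expuD.
    by congr (pi ^ _); have := tE _ jx; lia.
  - have e1 : (l == j'.+1 :> nat) = false by rewrite elj ltn_eqF.
    by rewrite [\val l == _]e1 !sub0r tofracN tofrac1 mulrN mulN1r -expuD elj addrC subrK.
have E : ratmx (col_mx y Z : 'M_(1 + x, x.+1)) *m dg x.+1 a *m
     (B1 *m (block_mx 1%:M 0 0 B2 : 'M_(1 + x, 1 + x))) =
   block_mx (pi ^ e 0%N)%:M 0 (pi ^ a 0%N *: (ratmx Z *m delta_mx ord0 ord0) )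
     (ratmx Y2 *m dg x b' *m B2).
  rewrite -mulmxA (mulmxA (dg x.+1 a)) E1 ratmx_col.
  rewrite (@mul_row_block _ x.+1 1 x 1 x) !mulmx0 mulmx1.
  rewrite addr0 add0r mul_col_row !mulmxA -!scalemxAr -!ratmxM yT ZT ratmx0 !mul0mx.
  congr block_mx; rewrite -colE; apply/matrixP => i j; rewrite !ord1 !mxE.
  rewrite /s big_ord0 subn0 tofrac_polyXn eqxx mulr1n -expuD.
  by congr (pi ^ _); lia.
set M := ratmx _ *m _ *m _ in E *.
have Eul i j : M (lshift x i) (lshift x j) = (pi ^ e 0%N)%:M i j.
  by rewrite E; exact: block_mxEul.
have Eur i j : M (lshift x i) (rshift 1 j) = (0 : 'M_(1, x)) i j.
  by rewrite E; exact: block_mxEur.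
have Edr i j : M (rshift 1 i) (rshift 1 j) = (ratmx Y2 *m dg x b' *m B2) i j.
  by rewrite E; exact: block_mxEdr.
clearbody M; split.
- apply: iunitM; first exact: uB1.
  by apply: (@iunit_diag _ _ 1 x) => //; exact: iunit1.
- move=> k; have [k'|k'] := splitP (k : 'I_(1 + x)).
    rewrite ord1 => ek; have -> : k = (lshift x (ord0 : 'I_1) : 'I_(1 + x)) by apply: val_inj.
    by rewrite Eul mxE.
  move=> ek; have -> : k = (rshift 1 k' : 'I_(1 + x)) by apply: val_inj.
  by rewrite Edr Y2d.
- move=> k j kj.
  have ej : (j : nat) = (1 + j.-1)%N by move: kj; clear; lia.
  have jx : (j.-1 < x)%N by move: (ltn_ord j) kj; clear; lia.
  have -> : j = (rshift 1 (Ordinal jx) : 'I_(1 + x)) by apply: val_inj.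
  have [k'|k'] := splitP (k : 'I_(1 + x)) => ek.
    have -> : k = (lshift x k' : 'I_(1 + x)) by apply: val_inj.
    by rewrite Eur mxE.
  have -> : k = (rshift 1 k' : 'I_(1 + x)) by apply: val_inj.
  rewrite Edr Y2u //=; move: kj; rewrite (ek : (k : nat) = (1 + k')%N); clear; lia.
Qed.

End Triangular.

(** * Interlacing chains *)

Section Interpolation.
Variables (r x y : nat) (p q : nat -> int).
Hypotheses (ndp : nondec r p) (ndq : nondec (r + x) q).
Hypothesis (qp : forall i, (i < r)%N -> q i <= p i).
Hypothesis (pq : forall i, (i + (x + y) < r + x)%N -> p i <= q (i + (x + y))%N).

(* chain1 goes from p to mid in y interlacing steps of constant length r, and
   chain2 from mid to q in x steps whose lengths grow by one. Both insert
   k copies of -oo in front of the source and take the maximum with the target. *)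
Definition mid i := Num.min (p i) (q (i + x)%N).
Definition chain1 k i := if (i < k)%N then mid i else Num.max (mid i) (p (i - k)%N).
Definition chain2 k j := if (j < k)%N then q j else Num.max (q j) (mid (j - k)%N).

Lemma mid_nondec : nondec r mid.
Proof.
move=> i j ij jr; have h1 := ndp ij jr.
have h2 : q (i + x)%N <= q (j + x)%N by apply: ndq; lia.
rewrite /mid; lia.
Qed.

Lemma chain1_0 i : (i < r)%N -> chain1 0 i = p i.
Proof. by move=> ir; rewrite /chain1 ltn0 subn0 /mid; lia. Qed.

(** By monotonicity and [pq], [p (i - y)] lies below both terms of [mid i]. *)
Lemma chain1_last i : (i < r)%N -> chain1 y i = mid i.
Proof.
move=> ir; rewrite /chain1; case: ltnP => // yi.
have h1 : p (i - y)%N <= p i by apply: ndp => //; exact: leq_subr.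
have := pq (i := (i - y)%N).
have -> : (i - y + (x + y) = i + x)%N by lia.
rewrite ltn_add2r => /(_ ir); rewrite /mid; lia.
Qed.

Lemma chain1_nondec k : nondec r (chain1 k).
Proof.
move=> i j ij jr; rewrite /chain1; have h := mid_nondec ij jr.
case: (ltnP i k) => ik; case: (ltnP j k) => jk; [lia|lia|lia|].
have h1 : p (i - k)%N <= p (j - k)%N by apply: ndp; lia.
lia.
Qed.

Lemma chain1_le k i : (i < r)%N -> chain1 k.+1 i <= chain1 k i.
Proof.
move=> ir; rewrite /chain1; case: (ltnP i k.+1) => ik; case: (ltnP i k) => ik'; try lia.
have h1 : p (i - k.+1)%N <= p (i - k)%N by apply: ndp; lia.
lia.
Qed.

Lemma chain1_ge k i : (i.+1 < r)%N -> chain1 k i <= chain1 k.+1 i.+1.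
Proof.
move=> ir; rewrite /chain1 ltnS subSS; have h := mid_nondec (leqnSn i) ir.
case: ltnP => ik; lia.
Qed.

Lemma le_mid i : (i < r)%N -> q i <= mid i.
Proof.
move=> ir; have := qp ir; have : q i <= q (i + x)%N by apply: ndq; lia.
rewrite /mid; lia.
Qed.

Lemma chain2_0 j : (j < r)%N -> chain2 0 j = mid j.
Proof. by move=> jr; rewrite /chain2 ltn0 subn0; have := le_mid jr; lia. Qed.

Lemma chain2_last j : (j < r + x)%N -> chain2 x j = q j.
Proof.
move=> jr; rewrite /chain2; case: ltnP => // xj.
by rewrite /mid subnK //; lia.
Qed.

Lemma chain2_nondec k : (k <= x)%N -> nondec (r + k) (chain2 k).
Proof.
move=> kx i j ij jr; have h : q i <= q j by apply: ndq; lia.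
rewrite /chain2; case: (ltnP i k) => ik; case: (ltnP j k) => jk; [lia|lia|lia|].
have h1 : mid (i - k)%N <= mid (j - k)%N by apply: mid_nondec; lia.
lia.
Qed.

Lemma chain2_le k i : (k < x)%N -> (i < r + k)%N -> chain2 k.+1 i <= chain2 k i.
Proof.
move=> kx ir; rewrite /chain2; case: (ltnP i k.+1) => ik; case: (ltnP i k) => ik'; try lia.
have h1 : mid (i - k.+1)%N <= mid (i - k)%N by apply: mid_nondec; lia.
lia.
Qed.

Lemma chain2_ge k i : (k < x)%N -> (i < r + k)%N -> chain2 k i <= chain2 k.+1 i.+1.
Proof.
move=> kx ir; rewrite /chain2 ltnS subSS.
have h : q i <= q i.+1 by apply: ndq; lia.
case: ltnP => ik; lia.
Qed.

Definition chain2_sum k := \sum_(i < r + k) chain2 k i.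
Definition chain2_gap k := chain2_sum k.+1 - chain2_sum k.

Lemma chain2_sumE k :
  chain2_sum k = \sum_(i < k) q i + \sum_(i < r) Num.max (q (i + k)%N) (mid i).
Proof.
rewrite /chain2_sum addnC big_split_ord /=; congr (_ + _); apply: eq_bigr => i _.
  by rewrite /chain2 ltn_ord.
by rewrite /chain2 ltnNge leq_addr /= addKn addnC.
Qed.

Lemma sum_chain2_gap k : \sum_(i < k) chain2_gap i = chain2_sum k - chain2_sum 0.
Proof.
elim: k => [|k IH]; first by rewrite big_ord0 subrr.
by rewrite big_ord_recr /= IH /chain2_gap; lia.
Qed.

(** The gaps telescope, and [q (i + k) <= q (i + x)] lets [p i] replace [mid i] in each
    difference. *)
Lemma sum_chain2_gap_max k : (k <= x)%N -> \sum_(i < k) chain2_gap i =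
  \sum_(i < r) Num.max (p i) (q (i + k)%N) + \sum_(i < k) q i - \sum_(i < r) p i.
Proof.
move=> kx; rewrite sum_chain2_gap !chain2_sumE big_ord0 add0r.
rewrite [RHS]addrAC [RHS]addrC -addrA; congr (_ + _).
rewrite -!sumrB; apply: eq_bigr => i _; rewrite addn0.
have := le_mid (ltn_ord i).
have h : q (i + k)%N <= q (i + x)%N by apply: ndq; have := ltn_ord i; lia.
rewrite /mid; lia.
Qed.

(** The difference of the two gaps is [q k.+1 - q k] plus the sum of the [A i - B i]. As max(a, t) -
    max(b, t) is nonincreasing in [t] for [a >= b], [B i.+1 <= A i]; pairing with this shift,
    [q k.+1 - q k] covers [B 0]. *)
Lemma chain2_gap_nondec k : (k.+1 < x)%N -> chain2_gap k <= chain2_gap k.+1.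
Proof.
move=> kx; pose A i := Num.max (q (i + k.+2)%N) (mid i) - Num.max (q (i + k.+1)%N) (mid i).
pose B i := Num.max (q (i + k.+1)%N) (mid i) - Num.max (q (i + k)%N) (mid i).
have AB i : (i < r)%N -> 0 <= A i /\ ((i.+1 < r)%N -> B i.+1 <= A i).
  move=> ir; have h1 : q (i + k.+1)%N <= q (i + k.+2)%N by apply: ndq; lia.
  split=> [|ir']; first by rewrite /A; lia.
  have h := mid_nondec (leqnSn i) ir'; rewrite /A /B !addSnnS; lia.
(* The second conjunct, that the partial sum covers the next [B j], carries the induction. *)
have h j : (j <= r)%N -> 0 <= q k.+1 - q k + (\sum_(i < j) A i - \sum_(i < j) B i) /\
   ((j < r)%N -> B j <= q k.+1 - q k + (\sum_(i < j) A i - \sum_(i < j) B i)).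
  elim: j => [|j IH] jr.
    rewrite !big_ord0 subrr addr0; have h : q k <= q k.+1 by apply: ndq; lia.
    by split=> [|r0]; rewrite /B ?add0n; lia.
  have [_ /(_ jr) hj] := IH (ltnW jr); have [A0 BA] := AB j jr.
  rewrite !big_ord_recr /=; split=> [|jr']; first by big_lia.
  by have := BA jr'; big_lia.
have [{}h _] := h r (leqnn r).
rewrite -subr_ge0; apply: le_trans h _.
have eA : \sum_(i < r) A i = \sum_(i < r) Num.max (q (i + k.+2)%N) (mid i)
    - \sum_(i < r) Num.max (q (i + k.+1)%N) (mid i) by rewrite -sumrB.
have eB : \sum_(i < r) B i = \sum_(i < r) Num.max (q (i + k.+1)%N) (mid i)
    - \sum_(i < r) Num.max (q (i + k)%N) (mid i) by rewrite -sumrB.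
rewrite eA eB /chain2_gap !chain2_sumE ![\sum_(i < _.+1) q i]big_ord_recr /=; big_lia.
Qed.

End Interpolation.

(** * Sufficiency *)

Section Sufficiency.
Variable F : fieldType.
Local Notation K := (ratfun F).
Local Notation pi := (unif (vinf F)).
Local Notation imx := (imx (vinf F)).
Local Notation has_orders := (has_orders (vinf F)).

Lemma has_orders_swap m z n (w : 'rV[{poly F}]_n) (P : 'M_(m, n)) (W : 'M_(z, n)) r q :
  has_orders (ratmx (col_mx w (col_mx P W))) r q ->
  has_orders (ratmx (col_mx P (col_mx w W))) r q.
Proof.
rewrite !ratmx_col => H.
have i1 k : imx (1%:M : 'M_k) by exact: imx1.
have i0 k l : imx (0 : 'M_(k, l)) by exact: imx0.
apply: (has_orders_equiv
  (A := col_mx (row_mx 0 (row_mx 1%:M 0)) (col_mx (row_mx 1%:M 0) (row_mx 0 (row_mx 0 1%:M))))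
  (B := 1%:M)
  (A' := col_mx (row_mx 0 (row_mx 1%:M 0)) (col_mx (row_mx 1%:M 0) (row_mx 0 (row_mx 0 1%:M))))
  (B' := 1%:M)) H; try exact: imx1.
- by apply: imx_col; [|apply: imx_col]; do ![apply: imx_row].
- by apply: imx_col; [|apply: imx_col]; do ![apply: imx_row].
- by rewrite mulmx1 !mul_col_mx !mul_row_col !mul0mx !mul1mx !(addr0, add0r).
- by rewrite mulmx1 !mul_col_mx !mul_row_col !mul0mx !mul1mx !(addr0, add0r).
Qed.

Section Construction.
Variables (m n r x y d : nat) (P : 'M[{poly F}]_(m, n)) (p q : nat -> int).
Hypotheses (ndq : nondec (r + x) q) (hP : has_orders (ratmx P) r p).
Hypothesis (qp : forall i, (i < r)%N -> q i <= p i).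
Hypothesis (pq : forall i, (i + (x + y) < r + x)%N -> p i <= q (i + (x + y))%N).
Let ndp : nondec r p := proj1 hP.

(** Staying in the row space of [P], these rows also vanish on the kernel vectors [f l] used
    afterwards. *)
Lemma add_rows_same k : (k <= y)%N -> exists W : 'M[{poly F}]_(k, n),
  has_orders (ratmx (col_mx P W)) r (chain1 x p q k) /\ (ratmx W <= ratmx P)%MS.
Proof.
elim: k => [|k IH] ky.
  exists 0; split.
    apply: (eq_has_orders (p := p)) => [i ir|]; first by rewrite (chain1_0 x p q ir).
    have -> : ratmx (col_mx P (0 : 'M_(0, n))) =
        col_mx (1%:M : 'M_m) (0 : 'M_(0, m)) *m ratmx P.
      by rewrite mul_col_mx mul1mx mul0mx ratmx_col ratmx0.
    apply: (has_orders_equiv (A := col_mx (1%:M : 'M_m) (0 : 'M_(0, m))) (B := 1%:M)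
      (A' := row_mx (1%:M : 'M_m) (0 : 'M_(m, 0))) (B' := 1%:M)) hP; try exact: imx1.
    - by apply: imx_col; [exact: imx1|exact: imx0].
    - by apply: imx_row; [exact: imx1|exact: imx0].
    - by rewrite mulmx1.
    - by rewrite mulmx1 mulmxA mul_row_col mulmx1 mul0mx addr0 mul1mx.
  by rewrite ratmx0 sub0mx.
have [W [hW WP]] := IH (ltnW ky).
have [u hu] : exists u : 'rV_(m + k),
    has_orders (col_mx (u *m ratmx (col_mx P W)) (ratmx (col_mx P W))) r (chain1 x p q k.+1).
  apply: (add_row_same hW) => [|i ir|i ir].
  - exact: chain1_nondec.
  - exact: (@chain1_le r).
  - exact: (@chain1_ge r).
rewrite -[u *m _]add0r -(ratmx0 F 1 n) in hu.
have [a ha] := has_orders_poly_row hu.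
suff [W' hW'] : exists W' : 'M[{poly F}]_(1 + k, n),
    has_orders (ratmx (col_mx P W')) r (chain1 x p q k.+1) /\ (ratmx W' <= ratmx P)%MS.
  by exists W'.
exists (col_mx (0 + a *m col_mx P W) W); split.
  exact: (has_orders_swap ha).
rewrite ratmx_col col_mx_sub WP andbT add0r ratmxM.
by rewrite (submx_trans (submxMl _ _)) // ratmx_col col_mx_sub submx_refl.
Qed.

Variables (f : 'I_x -> 'cV[K]_n) (g : 'I_x -> 'rV[K]_n) (w : 'I_x -> 'rV[{poly F}]_n).
Hypotheses (fint : forall k, imx (f k)) (gint : forall k, imx (g k)).
Hypotheses (Pf : forall k, ratmx P *m f k = 0) (gf : forall k, g k *m f k = 1%:M).
Hypothesis (wf : forall k j : 'I_x, (k < j)%N -> ratmx (w k) *m f j = 0).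
Hypothesis (wg : forall k, exists E : 'I_x -> K,
  (ratmx (w k) - pi ^ chain2_gap r x p q k *: g k - \sum_(l < x | (l < k)%N) E l *: g l
     <= ratmx P)%MS).

Lemma add_rows_new k : (k <= x)%N -> exists W : 'M[{poly F}]_(k + y, n),
  [/\ has_orders (ratmx (col_mx P W)) (r + k) (chain2 x p q k),
      forall l : 'I_x, (k <= l)%N -> ratmx W *m f l = 0
    & forall l : 'I_x, (l < k)%N -> (g l <= ratmx (col_mx P W))%MS].
Proof.
elim: k => [|k IH] kx.
  have [W [hW WP]] := add_rows_same (leqnn y); exists W; split=> //.
    rewrite addn0; apply: eq_has_orders hW => i ir.
    by rewrite (chain2_0 ndq qp ir) (chain1_last ndp pq ir).
  by move=> l _; have /submxP[D ->] := WP; rewrite -mulmxA Pf mulmx0.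
have [W [hW Wf Wg]] := IH (ltnW kx).
pose k' := Ordinal kx; pose M := ratmx (col_mx P W).
have PM : (ratmx P <= M)%MS by rewrite /M ratmx_col -addsmxE addsmxSl.
have Mf (l : 'I_x) : (k <= l)%N -> M *m f l = 0.
  by move=> kl; rewrite /M ratmx_col mul_col_mx Pf Wf // col_mx0.
have [E hE] := wg k'.
have inM : (ratmx (w k') - pi ^ chain2_gap r x p q k *: g k' <= M)%MS.
  rewrite -[X in (X <= _)%MS](subrK (\sum_(l < x | (l < k)%N) E l *: g l)).
  apply: addmx_sub; first exact: submx_trans hE PM.
  by apply: summx_sub => l lk; apply: scalemx_sub; exact: Wg.
have /submxP[u0 eu0] := inM.
have ev : ratmx (w k') = u0 *m M + pi ^ chain2_gap r x p q k *: g k'.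
  by rewrite -eu0 subrK.
have [u hu] : exists u : 'rV_(m + (k + y)),
   has_orders (col_mx (ratmx (w k') + u *m M) M) (r + k).+1 (chain2 x p q k.+1).
  apply: (add_row_new hW _ _ (fint k') (gint k') (Mf k' (leqnn k)) (gf k')).
  - by rewrite -addnS; exact: (chain2_nondec ndp ndq kx).
  - by move=> i ir; split; [exact: (chain2_le ndp ndq kx ir)|exact: (chain2_ge p ndq kx ir)].
  - by rewrite ev /chain2_gap /chain2_sum addnS.
have [a ha] := has_orders_poly_row hu.
suff [W' hW'] : exists W' : 'M[{poly F}]_(1 + (k + y), n),
    [/\ has_orders (ratmx (col_mx P W')) (r + k.+1) (chain2 x p q k.+1),
      forall l : 'I_x, (k.+1 <= l)%N -> ratmx W' *m f l = 0
    & forall l : 'I_x, (l < k.+1)%N -> (g l <= ratmx (col_mx P W'))%MS].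
  by exists W'.
exists (col_mx (w k' + a *m col_mx P W) W); split.
- by rewrite addnS; exact: (has_orders_swap ha).
- move=> l kl; rewrite ratmx_col mul_col_mx Wf ?(ltnW kl) // ratmxD mulmxDl wf //.
  by rewrite ratmxM -mulmxA Mf ?(ltnW kl) // mulmx0 addr0 col_mx0.
set M' := ratmx _.
have PM' : (ratmx P <= M')%MS by rewrite /M' ratmx_col -addsmxE addsmxSl.
have MM' : (M <= M')%MS.
  rewrite /M ratmx_col col_mx_sub PM' /M' !ratmx_col -addsmxE.
  by rewrite (submx_trans _ (addsmxSr _ _)) // -addsmxE addsmxSr.
have wM' : (ratmx (w k') <= M')%MS.
  have -> : ratmx (w k') = ratmx (w k' + a *m col_mx P W) - ratmx a *m M.
    by rewrite ratmxD ratmxM addrK.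
  apply: addmx_sub.
    rewrite /M' !ratmx_col -!addsmxE.
    by rewrite (submx_trans _ (addsmxSr _ _)) // -addsmxE addsmxSl.
  by rewrite eqmx_opp (submx_trans (submxMl _ _)).
move=> l; rewrite ltnS leq_eqVlt => /orP[/eqP lk|lk]; last exact: submx_trans (Wg l lk) MM'.
have -> : l = k' by apply: val_inj.
(* Solving for [g k'] shows that the new row brings it into the row space. *)
have -> : g k' = pi ^ (- chain2_gap r x p q k) *: (ratmx (w k') - u0 *m M).
  by rewrite ev addrAC subrr add0r scalerA -expuD addNr expr0z scale1r.
apply: scalemx_sub; apply: addmx_sub => //.
by rewrite eqmx_opp (submx_trans (submxMl _ _)).
Qed.

End Construction.
End Sufficiency.

(** * Polynomial rows dual to a minimal basis *)

Section Completion.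
Variable F : fieldType.
Local Notation K := (ratfun F).
Local Notation pi := (unif (vinf F)).
Local Notation imx := (imx (vinf F)).
Local Notation iunit := (iunit (vinf F)).
Local Notation dg := (dg (vinf F)).

Lemma row_mul_col (R : pzRingType) m n l (A : 'M[R]_(m, n)) (B : 'M_(n, l)) i j :
  row i A *m col j B = ((A *m B) i j)%:M.
Proof.
apply/matrixP => a b; rewrite !ord1 !mxE mulr1n.
by apply: eq_bigr => k _; rewrite !mxE.
Qed.

Lemma sorted_nondec (p : seq int) : sorted <=%O p -> nondec (size p) (fun i => p`_i).
Proof.
move=> sp i j ij jr; apply: (sorted_leq_nth le_trans le_refl) => //.
by rewrite inE (leq_ltn_trans ij).
Qed.

Lemma sum_nat_rev (c : nat -> nat) k x : (k <= x)%N ->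
  (\sum_(x - k <= i < x) c i = \sum_(i < k) c (x - i.+1))%N.
Proof.
move=> kx; rewrite -[(x - k)%N]add0n big_addn (subKn kx) big_nat_rev big_mkord.
by apply: eq_bigr => i _; congr c; have := ltn_ord i; lia.
Qed.

Section Kernel.
Variables (m n d x : nat) (P : 'M[{poly F}]_(m, n)) (N : 'M[{poly F}]_(n, d)) (c : seq nat).
Hypothesis PN : ratmx P *m ratmx N = 0.
Hypothesis Nspan : forall v : 'cV[K]_n, ratmx P *m v = 0 -> exists u, v = ratmx N *m u.
Hypothesis Nfree : forall u : 'cV[K]_d, ratmx N *m u = 0 -> u = 0.
Hypothesis Nsize : forall i j, (size (N i j) <= (nth 0%N c j).+1)%N.
Hypothesis Nexchange : forall (u : 'cV[K]_d) (w : 'cV[{poly F}]_n) i,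
  ratmx N *m u = ratmx w -> u i ord0 != 0 ->
  ~ forall l, (size (w l ord0) <= nth 0%N c i)%N.
Hypotheses (sc : sorted geq c) (xd : (x <= d)%N).

(** The columns of the cokernel of [P] are kernel vectors of [P], hence combinations of the columns
    of [N], and [A] kills them. *)
Lemma kernel_rows_sub (A : 'M[K]_(x, n)) : A *m ratmx N = 0 -> (A <= ratmx P)%MS.
Proof.
move=> AN; rewrite submxE; apply/eqP/matrixP => i j.
have Pj : ratmx P *m col j (cokermx (ratmx P)) = 0.
  by rewrite colE mulmxA mulmx_coker mul0mx.
have [u hu] := Nspan Pj.
have : A *m col j (cokermx (ratmx P)) = 0 by rewrite hu mulmxA AN mul0mx.
by move=> /matrixP/(_ i ord0); rewrite !mxE => h; rewrite -[RHS]h;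
  apply: eq_bigr => l _; rewrite !mxE.
Qed.

Variable e : nat -> int.
Hypothesis e_nondec : forall i, (i.+1 < x)%N -> e i <= e i.+1.
Hypothesis e_sum : forall k, (k <= x)%N ->
  \sum_(i < k) e i <= (\sum_(x - k <= i < x) nth 0%N c i)%N%:Z.

(* w_k has order e_k modulo the span of P and of the previous rows. *)
Lemma kernel_rows_exist :
  exists (f : 'I_x -> 'cV[K]_n) (g : 'I_x -> 'rV[K]_n) (w : 'I_x -> 'rV[{poly F}]_n),
  [/\ forall k, imx (f k) /\ imx (g k),
      forall k, ratmx P *m f k = 0 /\ g k *m f k = 1%:M,
      forall k j : 'I_x, (k < j)%N -> ratmx (w k) *m f j = 0
    & forall k : 'I_x, exists E : 'I_x -> K,
      (ratmx (w k) - pi ^ e k *: g k - \sum_(l < x | (l < k)%N) E l *: g l <= ratmx P)%MS].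
Proof.
have [L LN] := poly_left_inverse Nfree Nsize Nexchange.
have [G iG GN] := proper_left_inverse Nfree Nsize Nexchange.
have iN := minimal_mx_proper Nsize.
set cdg := dg d _ in GN iN.
(* The [x] largest indices, reversed into the nondecreasing order that [triangular_exists]
   requires. *)
pose a i := (nth 0%N c (x - i.+1))%:Z.
have [Y [B [[iB [B' [iB' BB' B'B]]] Ed Eu]]] : exists (Y : 'M[{poly F}]_x) (B : 'M[K]_x),
  [/\ iunit B, forall k, (ratmx Y *m dg x a *m B) k k = pi ^ e k
    & forall k j : 'I_x, (k < j)%N -> (ratmx Y *m dg x a *m B) k j = 0].
  apply: triangular_exists => // [i ix|k kx].
    by rewrite /a lez_nat; apply: sorted_geq_nth => //; apply: leq_sub2l.
  apply: le_trans (e_sum kx) _; rewrite sum_nat_rev //.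
  by rewrite (big_morph Posz PoszD (erefl _)).
have rhoP (j : 'I_x) : (x - j.+1 < d)%N by have := ltn_ord j; lia.
pose rho j := Ordinal (rhoP j).
have rhoI : injective rho.
  move=> i j /(congr1 val) /= h; apply: val_inj => /=.
  by move: (ltn_ord i) (ltn_ord j) h; clear; lia.
pose Na := ratmx (colsub rho N) *m dg x a.
have NaE : Na = colsub rho (ratmx N *m cdg).
  by apply/matrixP => i j; rewrite mul_dg [RHS]mxE mul_dg !mxE.
have GNa : rowsub rho G *m Na = 1%:M.
  have -> : rowsub rho G *m Na = mxsub rho rho (G *m (ratmx N *m cdg)).
    by rewrite NaE; apply/matrixP => i j; rewrite !mxE; apply: eq_bigr => l _; rewrite !mxE.
  by rewrite GN; apply/matrixP => i j; rewrite !mxE (inj_eq rhoI).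
(* Selected columns of the scaled basis and matching rows of its proper left inverse, changed by [B]
   and its inverse, form dual integral families. *)
pose Fm := Na *m B; pose Gm := B' *m rowsub rho G.
have iF : imx Fm by apply: imxM iB; rewrite NaE; apply: imx_sub; exact: iN.
have iGm : imx Gm by apply: imxM iB' _; apply: imx_sub; exact: iG.
have GF : Gm *m Fm = 1%:M by rewrite /Gm /Fm mulmxA -(mulmxA B') GNa mulmx1.
(* The polynomial left inverse [L] keeps [W0] polynomial, with [W0 N] equal to [Y] on the selected
   columns and zero elsewhere. *)
pose W0 := Y *m rowsub rho L; pose E := ratmx Y *m dg x a *m B.
have LNs : rowsub rho L *m N = rowsub rho 1%:M.
  by rewrite mul_rowsub_mx LN.
have W0N : ratmx W0 *m ratmx N = ratmx Y *m rowsub rho 1%:M.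
  rewrite -ratmxM /W0 -mulmxA LNs ratmxM; congr (_ *m _).
  by apply/matrixP => i j; rewrite !mxE rmorph_nat.
have PF : ratmx P *m Fm = 0.
  rewrite /Fm NaE mulmxA.
  suff -> : ratmx P *m colsub rho (ratmx N *m cdg) = 0 by rewrite mul0mx.
  have : ratmx P *m (ratmx N *m cdg) = 0 by rewrite mulmxA PN mul0mx.
  move=> /matrixP h; apply/matrixP => i j; have := h i (rho j); rewrite !mxE => {2}<-.
  by apply: eq_bigr => l _; rewrite !mxE.
have W0F : ratmx W0 *m Fm = E.
  rewrite /Fm /E !mulmxA -ratmxM; congr (ratmx _ *m _ *m _).
  rewrite /W0 -mulmxA -[RHS]mulmx1; congr (_ *m _).
  apply/matrixP => i j; transitivity ((rowsub rho L *m N) i (rho j)).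
    by rewrite !mxE; apply: eq_bigr => l _; rewrite !mxE.
  by rewrite LNs !mxE (inj_eq rhoI).
have GmN : E *m Gm *m ratmx N = ratmx Y *m rowsub rho 1%:M.
  rewrite /E /Gm !mulmxA -(mulmxA _ B) BB' mulmx1 -!mulmxA; congr (_ *m _).
  have cGN : cdg *m (G *m ratmx N) = 1%:M.
    by apply: mulmx1C; rewrite -mulmxA.
  apply/matrixP => i j; rewrite dg_mul mul_rowsub_mx [LHS]mulrC mxE mulrC.
  have := congr1 (fun A : 'M[K]_d => A (rho i) j) cGN.
  by rewrite dg_mul [RHS]mxE => ->; rewrite !mxE.
(* [W0] and [E *m Gm] agree on [N], hence modulo the row space of [P], and [E] is lower triangular
   with diagonal [pi ^ e k]. *)
have WE : (ratmx W0 - E *m Gm <= ratmx P)%MS.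
  by apply: kernel_rows_sub; rewrite mulmxBl W0N GmN subrr.
exists (fun k => col k Fm), (fun k => row k Gm), (fun k => row k W0).
have rowW k : ratmx (row k W0) = row k (ratmx W0) by exact: map_row.
split.
- by move=> k; split=> i j; rewrite mxE; [exact: iF|exact: iGm].
- move=> k; split; last by rewrite row_mul_col GF mxE eqxx.
  by rewrite colE mulmxA PF mul0mx.
- by move=> k j kj; rewrite rowW row_mul_col W0F Eu // raddf0.
move=> k; exists (E k).
have := submx_trans (row_sub k _) WE.
have -> : row k (ratmx W0 - E *m Gm) =
   row k (ratmx W0) - (pi ^ e k *: row k Gm + \sum_(l < x | (l < k)%N) E k l *: row l Gm).
  rewrite raddfB /= row_mul mulmx_sum_row (bigD1 k) //= mxE Ed; congr (_ - (_ + _)).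
  rewrite (bigID (fun l : 'I_x => (l < k)%N)) /= [X in _ + X]big1 ?addr0.
    apply: eq_big => [l|l _]; last by rewrite mxE.
    by rewrite andb_idl // => lk; rewrite -val_eqE ltn_eqF.
  move=> l; rewrite -leqNgt => /andP[lk kl]; rewrite mxE Eu ?scale0r //.
  by rewrite ltn_neqAle kl andbT eq_sym.
by rewrite opprD addrA rowW.
Qed.

End Kernel.
End Completion.

(* Sequences are indexed from 0: p`_i, q`_i, c`_i stand for p_(i+1), q_(i+1),
   c_(i+1). The bound p_i <= q_(i+z) is void when i + z > r + x, where
   q_(i+z) = +oo by convention; all other indices are in range. *)
Theorem theorem4p5 (F : fieldType) (m n r z x : nat)
    (P : 'M[{poly F}]_(m, n))
    (p : r.-tuple int) (c : (n - r).-tuple nat) (q : (r + x).-tuple int)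
    (rankP : \rank (ratmx P) = r)
    (ordersP : invariant_orders_at_infinity (ratmx P) p)
    (indicesP : column_minimal_indices (ratmx P) c)
    (x_le : (x <= minn z (n - r))%N)
    (q_sorted : sorted <=%O q) :
  (exists W : 'M[{poly F}]_(z, n),
     \rank (ratmx (col_mx P W)) = (r + x)%N /\
     invariant_orders_at_infinity (ratmx (col_mx P W)) q)
  <->
  (forall i : nat, (i < r)%N ->
     q`_i <= p`_i /\ ((i + z < r + x)%N -> p`_i <= q`_(i + z))) /\
  (forall j : nat, (j < x)%N ->
     \sum_(0 <= i < r) Num.max p`_i q`_(i + (x - j))
       + \sum_(0 <= i < x - j) q`_i - \sum_(0 <= i < r) p`_i
     <= \sum_(j <= i < x) (nth 0%N c i)%:Z).
Proof.
have rn : (r <= n)%N by rewrite -rankP rank_leq_col.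
have nrd : n = (r + (n - r))%N by rewrite subnKC.
have xz : (x <= z)%N := leq_trans x_le (geq_minl _ _).
have xd : (x <= n - r)%N := leq_trans x_le (geq_minr _ _).
have hP : has_orders (vinf F) (ratmx P) r (fun i => p`_i).
  by have /invariant_ordersP := ordersP; rewrite size_tuple.
have ndq : nondec (r + x) (fun i => q`_i).
  by have := sorted_nondec q_sorted; rewrite size_tuple.
have sc : sorted geq c := proj1 indicesP.
have [N [PN Nspan Nfree Nsize Nexch]] := minimal_basis_mx indicesP (size_tuple c).
have sumc j : (\sum_(j <= i < x) nth 0 c i)%N%:Z = \sum_(j <= i < x) (nth 0%N c i)%:Z.
  exact: (big_morph Posz PoszD (erefl _)).
split=> [[W [_ /invariant_ordersP]]|].
  rewrite size_tuple => hM; split=> [i ir|j jx].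
    by split=> [|iz]; [exact: (orders_le hP hM ir)|exact: (orders_ge hP hM iz)].
  have := order_sum_le hP hM PN (minimal_mx_rank Nfree) nrd sc
    (minimal_mx_proper Nsize) (leq_subr j x).
  by rewrite (subKn (ltnW jx)) sumc !big_mkord.
move=> [pq_le sum_le].
(* Of the [z] rows, [y] keep the rank and [x] raise it. *)
have [y ezy] : exists y, z = (x + y)%N by exists (z - x)%N; rewrite subnKC.
subst z.
have qp i : (i < r)%N -> q`_i <= p`_i by move=> ir; case: (pq_le i ir).
have pq i : (i + (x + y) < r + x)%N -> p`_i <= q`_(i + (x + y)).
  move=> h; have ir : (i < r)%N by lia.
  by case: (pq_le i ir) => _; apply.
have e_nondec i : (i.+1 < x)%N -> _ := @chain2_gap_nondec r x _ _ (proj1 hP) ndq i.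
have e_sum k : (k <= x)%N -> \sum_(i < k) chain2_gap r x (fun i => p`_i) (fun i => q`_i) i
    <= (\sum_(x - k <= i < x) nth 0 c i)%N%:Z.
  (* A partial sum of length [k.+1] is the left-hand side for [j = x - k.+1]. *)
  case: k => [|k] kx; first by rewrite big_ord0.
  have := sum_le (x - k.+1)%N; rewrite !big_mkord (subKn kx) -sumc.
  rewrite (sum_chain2_gap_max ndq qp kx); apply; lia.
have [f [g [w [fg_int Pf_gf wf wg]]]] :=
  kernel_rows_exist PN Nspan Nfree Nsize Nexch sc xd e_nondec e_sum.
have [W [hW _ _]] := add_rows_new ndq hP qp pq (fun k => proj1 (fg_int k))
  (fun k => proj2 (fg_int k)) (fun k => proj1 (Pf_gf k)) (fun k => proj2 (Pf_gf k))
  wf wg (leqnn x).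
exists W; split; first exact: has_orders_rank hW.
apply/invariant_ordersP; rewrite size_tuple.
by apply: eq_has_orders hW => i ir; rewrite (chain2_last _ _ ir).
Qed.
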